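(* There exists a finite matrix $\widetilde M\in\{-1,+1\}^{m\times N}$ with weak-learning margin $\gamma(\widetilde M)=\frac15>0$ such that exhaustive AdaBoost on $\widetilde M$ with smallest-index tie-breaking, started from the exact uniform distribution $D_1(i)=1/m$ for all $i$, does not converge to any finite cycle.
   Context: Exhaustive AdaBoost on a matrix $M\in\{-1,+1\}^{m\times N}$: given a state $D_t\in\Delta^{m-1}$ (the probability simplex in $\mathbb R^m$), the edges are $\mu_t(j)=(D_t^\top M)_j$, the selected column is $j_t=\min\operatorname{argmax}_{1\le j\le N}\mu_t(j)$ (smallest-index tie-breaking), $r_t=\mu_t(j_t)$, and the update is $D_{t+1}(i)=D_t(i)/(1+r_tM_{ij_t})$. The weak-learning margin is $\gamma(M)=\min_{D\in\Delta^{m-1}}\max_{1\le j\le N}(D^\top M)_j$. The sequence $(D_t)_{t\ge1}$ converges to a cycle of length $\ell\ge1$ if there exist $\widetilde D_0,\dots,\widetilde D_{\ell-1}$ with $D_{k\ell+b}\to\widetilde D_b$ as $k\to\infty$ for every $b\in\{0,\dots,\ell-1\}$; it converges to a finite cycle if it converges to a cycle of some finite length $\ell$. *)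

(* Defs.v *)
From HB Require Import structures.
From mathcomp Require Import all_boot all_order all_algebra.
From mathcomp Require Import all_classical all_reals all_analysis.
Set Implicit Arguments. Unset Strict Implicit. Unset Printing Implicit Defensive.
Import Order.TTheory GRing.Theory Num.Theory.
Import numFieldNormedType.Exports.
Local Open Scope classical_set_scope.
Local Open Scope ring_scope.

Section Ada.
Variables (R : realType) (m N : nat).

Definition pm_matrix (M : 'M[R]_(m, N)) : Prop :=
  forall i j, M i j = 1 \/ M i j = -1.

Definition simplex : set 'rV[R]_m :=
  [set D | (forall i, 0 <= D 0 i) /\ \sum_(i < m) D 0 i = 1].

Definition edge (M : 'M[R]_(m, N)) (D : 'rV[R]_m) (j : 'I_N) : R :=
  \sum_(i < m) D 0 i * M i j.

(* max_j mu(j) (sup of a finite nonempty set = its maximum) *)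
Definition max_edge (M : 'M[R]_(m, N)) (D : 'rV[R]_m) : R :=
  sup [set edge M D j | j in [set: 'I_N]].

(* gamma(M) = min_{D in simplex} max_j (D^T M)_j  (the min is attained, = inf) *)
Definition margin (M : 'M[R]_(m, N)) : R :=
  inf [set max_edge M D | D in simplex].

Definition sel (M : 'M[R]_(m, N)) (D : 'rV[R]_m) : option 'I_N :=
  [pick j | [forall k, edge M D k <= edge M D j] &&
            [forall k : 'I_N, (k < j)%N ==> (edge M D k < edge M D j)]].

Definition ada_step (M : 'M[R]_(m, N)) (D : 'rV[R]_m) : 'rV[R]_m :=
  match sel M D with
  | Some j => \row_i (D 0 i / (1 + edge M D j * M i j))
  | None => D
  end.

Definition uniform : 'rV[R]_m := \row_i (m%:R)^-1.

(* D_t for t >= 1 : D_1 = uniform, D_{t+1} = ada_step D_t (index 0 unused, = D_1) *)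
Definition ada_seq (M : 'M[R]_(m, N)) (t : nat) : 'rV[R]_m :=
  iter t.-1 (ada_step M) uniform.

Definition converges_to_cycle (D : nat -> 'rV[R]_m) (l : nat) : Prop :=
  (1 <= l)%N /\
  exists Dt : nat -> 'rV[R]_m,
    forall b, (b < l)%N -> (fun k => D (k * l + b)%N) @ \oo --> Dt b.

Definition converges_to_finite_cycle (D : nat -> 'rV[R]_m) : Prop :=
  exists l, converges_to_cycle D l.

End Ada.

(* Main.v *)
From Stdlib Require Import BinPosDef BinIntDef.
From Stdlib Require Import -(notations) ZArith QArith Qabs.
Require Import Defs.
From HB Require Import structures.
From mathcomp Require Import all_boot all_order all_algebra.
From mathcomp Require Import all_classical all_reals all_analysis.
From mathcomp Require Import zify ssrZ ring lra.
Set Implicit Arguments. Unset Strict Implicit. Unset Printing Implicit Defensive.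
Import Order.TTheory GRing.Theory Num.Theory.
Local Open Scope ring_scope.

(** The rows of the matrix are pairs of rows of two five-column gadgets A and B (with
    multiplicities), and its columns are those of A followed by those of B.  The AdaBoost
    weights stay a product, and each step moves only the factor with the larger maximal edge.
    Each factor, moving alone, is attracted to a ten-step cycle whose first edge is a
    bottleneck [7/23] below the nine others, so a factor that starts its cycle completes it
    while the other waits.  The excess of the bottleneck edge over [7/23] decides who moves;
    per cycle it is multiplied asymptotically by [1/5] for A (its perturbation is an extra
    row type) and, for B, by a root [la] of an irreducible rational cubic which has another
    root of smaller modulus, so that no power of [la] is a power of [1/5].  If the orbit
    converged to a finite cycle, the winners would be eventually periodic with [al] cycles
    of A and [be] cycles of B per period, forcing [(1/5) ^+ al = la ^+ be].

    The local behaviour at the base cycle is obtained by exact rational arithmetic with dual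
    numbers: a truncated expansion is propagated through the ten steps, and invariant cones
    in the relative coordinates control the remainder. *)

(** Under a product distribution the edge of a column of one gadget depends only on the marginal of
    that gadget, and its update multiplies a row by a factor depending only on that component, so
    the other marginal is untouched. One gadget near its cycle would simply converge to it;
    aperiodicity has to come from the order in which two convergent factors take turns. Both
    bottleneck edges tend to 7/23 from above, so the order is decided by ever smaller excesses, yet
    every decision shows at a fixed scale: one step into a turn, the edge of column 0 is either 0 or
    above 7/23. Hence two-sided geometric bounds with unknown constants suffice; no excess is ever
    computed. The uniform start is met by repeating rows: an integer initial state gives every row
    type an integer weight, which becomes its multiplicity. Integer deviations from a large [N] are
    relative deviations of order [1 / N], so both factors start inside their cones. *)

Notation Q0 := (Qmake Z0 1).
Notation Q1 := (Qmake (Zpos 1) 1).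

(** * Computable rationals inside an ordered field *)

Section RationalConstants.
Variable R : realFieldType.

Definition ZR (z : Z) : R := (int_of_Z z)%:~R.
Definition qR (q : Q) : R := ZR (Qnum q) / ZR (Zpos (Qden q)).

Lemma ZR_add a b : ZR (Z.add a b) = ZR a + ZR b.
Proof. by rewrite /ZR -intrD; congr (_%:~R); rewrite -(rmorphD int_of_Z). Qed.

Lemma ZR_mul a b : ZR (Z.mul a b) = ZR a * ZR b.
Proof. by rewrite /ZR -intrM; congr (_%:~R); rewrite -(rmorphM int_of_Z). Qed.

Lemma ZR_opp a : ZR (Z.opp a) = - ZR a.
Proof. by rewrite /ZR -rmorphN; congr (_%:~R); rewrite -(rmorphN int_of_Z). Qed.

Lemma ZR_le a b : Z.le a b -> ZR a <= ZR b.
Proof. by move=> h; rewrite /ZR ler_int; lia. Qed.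

Lemma ZR_lt a b : Z.lt a b -> ZR a < ZR b.
Proof. by move=> h; rewrite /ZR ltr_int; lia. Qed.

Lemma ZR_nat n : ZR (Z.of_nat n) = n%:R.
Proof.
rewrite /ZR -[RHS]/(Posz n)%:~R; congr (_%:~R); lia.
Qed.

Lemma ZR_pos p : 0 < ZR (Zpos p).
Proof. by rewrite -[0]/(ZR Z0); apply: ZR_lt; lia. Qed.

Lemma ZR_pos_neq0 p : ZR (Zpos p) != 0.
Proof. by rewrite gt_eqF // ZR_pos. Qed.

Lemma qR_eq a b : Qeq a b -> qR a = qR b.
Proof.
rewrite /Qeq /qR => h; apply/eqP; rewrite eqr_div ?ZR_pos_neq0 //.
by rewrite -!ZR_mul h.
Qed.

Lemma qR_red a : qR (Qred a) = qR a.
Proof. exact/qR_eq/Qred_correct. Qed.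

Lemma qR_add a b : qR (Qplus a b) = qR a + qR b.
Proof.
by rewrite /qR addf_div ?ZR_pos_neq0 //= Pos2Z.inj_mul ZR_add !ZR_mul.
Qed.

Lemma qR_mul a b : qR (Qmult a b) = qR a * qR b.
Proof. by rewrite /qR mulf_div /= Pos2Z.inj_mul !ZR_mul. Qed.

Lemma qR_opp a : qR (Qopp a) = - qR a.
Proof. by rewrite /qR /= ZR_opp mulNr. Qed.

(** No condition on [a]: both inverses send 0 to 0. *)
Lemma qR_inv a : qR (Qinv a) = (qR a)^-1.
Proof.
case: a => [[|p|p] d]; rewrite /qR /Qinv /=.
- by rewrite /ZR rmorph0 !mul0r invr0.
- by rewrite invfM invrK mulrC.
rewrite -[Zneg d]/(Z.opp (Zpos d)) -[Zneg p]/(Z.opp (Zpos p)) !ZR_opp.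
by rewrite mulNr mulNr invrN invfM invrK mulrC.
Qed.

Lemma qR_le a b : Qle_bool a b -> qR a <= qR b.
Proof.
move=> /Qle_bool_iff; rewrite /Qle /qR => h.
by rewrite ler_pdivrMr ?ZR_pos // mulrAC ler_pdivlMr ?ZR_pos // -!ZR_mul ZR_le.
Qed.

Definition Qlt_b a b := negb (Qle_bool b a).

Lemma qR_lt a b : Qlt_b a b -> qR a < qR b.
Proof.
move=> /negP h; have : Qlt a b.
  by apply/Qnot_le_lt => /Qle_bool_iff; apply: h.
rewrite /Qlt /qR => {}h.
by rewrite ltr_pdivrMr ?ZR_pos // mulrAC ltr_pdivlMr ?ZR_pos // -!ZR_mul ZR_lt.
Qed.

Lemma qR0 : qR Q0 = 0. Proof. by rewrite /qR /ZR rmorph0 mul0r. Qed.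

Lemma qR1 : qR Q1 = 1.
Proof. by rewrite /qR /= divff // ZR_pos_neq0. Qed.

Lemma qR_neq0 a : ~~ Qeq_bool a Q0 -> qR a != 0.
Proof.
move=> h; rewrite /qR mulf_neq0 ?invr_neq0 ?ZR_pos_neq0 //.
apply/eqP => h0; move/negP: h; apply; apply/Qeq_bool_iff.
have {h0} : Qnum a = Z0.
  by move/eqP: h0; rewrite /ZR intr_eq0 => /eqP; lia.
by rewrite /Qeq => -> /=.
Qed.

Lemma qR_abs a : qR (Qabs a) = `|qR a|.
Proof.
case: (Qlt_le_dec a Q0) => h.
  rewrite (qR_eq (Qabs_neg a _)); last exact: Qlt_le_weak.
  rewrite qR_opp ltr0_norm // -qR0; apply: qR_lt; rewrite /Qlt_b.
  by apply/negP => /Qle_bool_iff; apply: Qlt_not_le.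
rewrite (qR_eq (Qabs_pos a h)) ger0_norm // -qR0.
by apply: qR_le; apply/Qle_bool_iff.
Qed.

End RationalConstants.

Arguments Qred : simpl never.
Arguments Qplus : simpl never.
Arguments Qmult : simpl never.
Arguments Qinv : simpl never.
Arguments Qopp : simpl never.

(** Dual numbers in five infinitesimals: value and gradient. *)
Definition dual := (Q * seq Q)%type.
Definition gr (l : seq Q) i := nth Q0 l i.
Definition dcst (q : Q) : dual := (q, nseq 5 Q0).
Definition dvar (q : Q) (k : nat) : dual :=
  (q, mkseq (fun i => if i == k then Q1 else Q0) 5).
(** The reductions by [Qred] keep the fractions small over ten steps of exact computation. *)
Definition dadd (a b : dual) : dual :=
  (Qred (Qplus a.1 b.1), mkseq (fun i => Qred (Qplus (gr a.2 i) (gr b.2 i))) 5).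
Definition dmul (a b : dual) : dual :=
  (Qred (Qmult a.1 b.1),
   mkseq (fun i => Qred (Qplus (Qmult a.1 (gr b.2 i)) (Qmult b.1 (gr a.2 i)))) 5).
Definition dinv (a : dual) : dual :=
  let u := Qred (Qinv a.1) in let w := Qred (Qopp (Qmult u u)) in
  (u, mkseq (fun i => Qred (Qmult w (gr a.2 i))) 5).

(** * Quadratic remainders of dual-number expansions *)

Section Dual.
Variable R : realFieldType.
Local Notation qR := (@qR R).
Implicit Types (v : nat -> R) (m : R) (f g : (nat -> R) -> R).

Definition lin (l : seq Q) v : R := \sum_(i < 5) qR (gr l i) * v i.
Definition lin_norm (l : seq Q) : R := \sum_(i < 5) `|qR (gr l i)|.
Definition small v m := forall i, (i < 5)%N -> `|v i| <= m.

(** One [K] bounds the quadratic remainder and, through [m * K <= 1], the radius of validity. It may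
    always be enlarged, which is how the constants of subexpressions are combined. *)
Definition expands f (d : dual) := exists2 K : R, 0 < K &
  forall v m, 0 <= m -> m * K <= 1 -> small v m ->
    `|f v - qR d.1 - lin d.2 v| <= K * m ^+ 2.

Lemma lin_le l v m : small v m -> `|lin l v| <= lin_norm l * m.
Proof.
move=> sv; rewrite /lin_norm mulr_suml; apply: le_trans (ler_norm_sum _ _ _) _.
by apply: ler_sum => i _; rewrite normrM ler_wpM2l // sv.
Qed.

Lemma lin_norm_ge0 l : 0 <= lin_norm l.
Proof. exact: sumr_ge0. Qed.

Lemma lin_mkseq h v :
  lin (mkseq h 5) v = \sum_(i < 5) qR (h i) * v i.
Proof. by apply: eq_bigr => i _; rewrite /gr nth_mkseq. Qed.

(** Products and inverses also need a first-order bound; it is obtained by absorbing the gradient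
    norm into [K]. *)
Lemma expandsW f d : expands f d -> exists2 K : R, 0 < K &
  forall v m, 0 <= m -> m * K <= 1 -> small v m ->
    `|f v - qR d.1 - lin d.2 v| <= K * m ^+ 2 /\ `|f v - qR d.1| <= K * m.
Proof.
case=> K K0 H; have L0 := lin_norm_ge0 d.2.
exists (K + lin_norm d.2 + 1); first by lra.
move=> v m m0 mK sv.
have mK' : m * K <= 1.
  by apply: le_trans mK; rewrite ler_wpM2l //; lra.
have h1 := H _ _ m0 mK' sv; have h2 := lin_le d.2 sv.
have m2 : 0 <= m ^+ 2 by apply: sqr_ge0.
split; first by apply: le_trans h1 _; rewrite ler_wpM2r //; lra.
have -> : f v - qR d.1 = (f v - qR d.1 - lin d.2 v) + lin d.2 v by ring.
apply: le_trans (ler_normD _ _) _; apply: le_trans (lerD h1 h2) _.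
have : K * m ^+ 2 <= m by nra.
nra.
Qed.

Lemma expands_cst q : expands (fun=> qR q) (dcst q).
Proof.
exists 1 => // v m m0 _ _; rewrite subrr sub0r normrN /lin big1 ?normr0.
  by rewrite mul1r sqr_ge0.
by move=> i _; rewrite /gr nth_nseq if_same qR0 mul0r.
Qed.

Lemma expands_var q k : (k < 5)%N ->
  expands (fun v => qR q + v k) (dvar q k).
Proof.
move=> k5; exists 1 => // v m m0 _ _.
rewrite lin_mkseq (bigD1 (Ordinal k5)) //= eqxx qR1 mul1r big1 ?addr0.
  by rewrite [qR q + _]addrC addrK subrr normr0 mul1r sqr_ge0.
by move=> i ik; have /negPf -> : (i : nat) != k := ik; rewrite qR0 mul0r.
Qed.

Lemma expands_add f g a b : expands f a -> expands g b ->
  expands (fun v => f v + g v) (dadd a b).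
Proof.
move=> [K K0 H] [K' K0' H']; exists (K + K'); first by lra.
move=> v m m0 mK sv.
have h1 : `|f v - qR a.1 - lin a.2 v| <= K * m ^+ 2 by apply: H => //; nra.
have h2 : `|g v - qR b.1 - lin b.2 v| <= K' * m ^+ 2 by apply: H' => //; nra.
rewrite lin_mkseq /= qR_red qR_add.
have -> : \sum_(i < 5) qR (Qred (Qplus (gr a.2 i) (gr b.2 i))) * v i
          = lin a.2 v + lin b.2 v.
  by rewrite -big_split; apply: eq_bigr => i _; rewrite qR_red qR_add mulrDl.
rewrite [X in `|X|](_ : _ = (f v - qR a.1 - lin a.2 v) + (g v - qR b.1 - lin b.2 v)).
  apply: le_trans (ler_normD _ _) _; lra.
by ring.
Qed.

Lemma expands_mul f g a b : expands f a -> expands g b ->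
  expands (fun v => f v * g v) (dmul a b).
Proof.
move=> /expandsW [K K0 H] /expandsW [K' K0' H'].
set A := `|qR a.1|; set B := `|qR b.1|.
have A0 : 0 <= A := normr_ge0 _; have B0 : 0 <= B := normr_ge0 _.
have KK : 0 < K * K' by apply: mulr_gt0.
exists (K + K' + K * K' + A * K' + B * K); first by nra.
move=> v m m0 mK sv.
have mK1 : m * K <= 1 by apply: le_trans mK; apply: ler_wpM2l => //; nra.
have mK2 : m * K' <= 1 by apply: le_trans mK; apply: ler_wpM2l => //; nra.
have [h1 h3] := H _ _ m0 mK1 sv.
have [h2 h4] := H' _ _ m0 mK2 sv.
rewrite lin_mkseq /= qR_red qR_mul.
have -> : \sum_(i < 5) qR (Qred (Qplus (Qmult a.1 (gr b.2 i)) (Qmult b.1 (gr a.2 i)))) * v i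
          = qR a.1 * lin b.2 v + qR b.1 * lin a.2 v.
  rewrite !mulr_sumr -big_split; apply: eq_bigr => i _.
  by rewrite /= qR_red qR_add !qR_mul; ring.
rewrite [X in `|X|](_ : _ = (f v - qR a.1) * (g v - qR b.1)
   + (qR a.1 * (g v - qR b.1 - lin b.2 v) + qR b.1 * (f v - qR a.1 - lin a.2 v)));
  last by ring.
have e1 : `|(f v - qR a.1) * (g v - qR b.1)| <= K * m * (K' * m).
  by rewrite normrM ler_pM.
have e2 : `|qR a.1 * (g v - qR b.1 - lin b.2 v)| <= A * (K' * m ^+ 2).
  by rewrite normrM ler_wpM2l.
have e3 : `|qR b.1 * (f v - qR a.1 - lin a.2 v)| <= B * (K * m ^+ 2).
  by rewrite normrM ler_wpM2l.
apply: le_trans (ler_normD _ _) _.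
apply: le_trans (lerD e1 (le_trans (ler_normD _ _) (lerD e2 e3))) _.
have m2 : 0 <= m ^+ 2 by apply: sqr_ge0.
have -> : K * m * (K' * m) = K * K' * m ^+ 2 by ring.
have -> : A * (K' * m ^+ 2) = A * K' * m ^+ 2 by ring.
have -> : B * (K * m ^+ 2) = B * K * m ^+ 2 by ring.
rewrite -!mulrDl ler_wpM2r //; nra.
Qed.

Lemma expands_inv f a : ~~ Qeq_bool a.1 Q0 -> expands f a ->
  expands (fun v => (f v)^-1) (dinv a).
Proof.
move=> /(@qR_neq0 R) a0 /expandsW [K K0 H].
set c := qR a.1; have c0 : 0 < `|c| by rewrite normr_gt0.
set k := `|c|^-1; have k0 : 0 < k by rewrite invr_gt0.
(* The summand [2 * K * k] shrinks the radius until [f v] stays within [|c| / 2] of [c]; the two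
   middle summands are the coefficients of the remainder. *)
exists (2 * K * k + 2 * k ^+ 3 * K ^+ 2 + K * k ^+ 2 + K).
  have : 0 < k ^+ 3 * K ^+ 2 by rewrite mulr_gt0 ?exprn_gt0.
  have : 0 < k ^+ 2 * K by rewrite mulr_gt0 ?exprn_gt0.
  nra.
move=> v m m0 mK sv.
have p1 : 0 <= K * k by rewrite mulr_ge0 // ltW.
have p2 : 0 <= k ^+ 3 * K ^+ 2 by rewrite mulr_ge0 ?exprn_ge0 // ltW.
have p3 : 0 <= K * k ^+ 2 by rewrite mulr_ge0 ?exprn_ge0 // ltW.
have mK1 : m * K <= 1 by apply: le_trans mK; apply: ler_wpM2l => //; lra.
have mK2 : m * (2 * K * k) <= 1 by apply: le_trans mK; apply: ler_wpM2l => //; lra.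
have [h1 h2] := H _ _ m0 mK1 sv.
set x := f v; rewrite -/x -/c in h1 h2.
have ck : `|c| * k = 1 by rewrite divff // gt_eqF.
have xc : `|c| <= 2 * `|x|.
  have : `|c| <= `|x| + `|x - c|.
    have := ler_normB x (x - c); rewrite opprB addrCA subrr addr0; lra.
  have : K * m * 2 <= `|c|.
    by rewrite -[X in _ <= X](mulr1) -ck; nra.
  lra.
have x0 : 0 < `|x| by lra.
have xk : `|x|^-1 <= 2 * k.
  rewrite -[2]invrK -invfM lef_pV2 ?posrE ?mulr_gt0 ?invr_gt0 //.
  by rewrite mulrC ler_pdivrMr //; lra.
have xn : x != 0 by rewrite -normr_gt0.
rewrite lin_mkseq /=.
have -> : \sum_(i < 5) qR (Qred (Qmult (Qred (Qopp (Qmult (Qred (Qinv a.1)) (Qred (Qinv a.1)))))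
   (gr a.2 i))) * v i = - (c^-1 * c^-1) * lin a.2 v.
  rewrite mulr_sumr; apply: eq_bigr => i _.
  by rewrite qR_red qR_mul qR_red qR_opp qR_mul !qR_red !qR_inv -/c; ring.
rewrite qR_red qR_inv -/c.
rewrite [X in `|X|](_ : _ = (x - c) ^+ 2 * (c^-1 * c^-1) * x^-1
                          - (c^-1 * c^-1) * (x - c - lin a.2 v)); last first.
  by field; rewrite xn a0.
have e1 : `|(x - c) ^+ 2 * (c^-1 * c^-1) * x^-1| <= (K * m) ^+ 2 * k ^+ 2 * (2 * k).
  rewrite !normrM !normfV -/k -!expr2.
  have q2 : `|x - c| ^+ 2 <= (K * m) ^+ 2.
    by rewrite ler_sqr ?nnegrE // mulr_ge0 // ltW.
  have k2 : 0 <= k ^+ 2 by rewrite exprn_ge0 // ltW.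
  by apply: ler_pM => //; rewrite ?mulr_ge0 ?sqr_ge0 ?invr_ge0 ?ler_wpM2r.
have e2 : `|(c^-1 * c^-1) * (x - c - lin a.2 v)| <= k ^+ 2 * (K * m ^+ 2).
  by rewrite normrM normrM !normfV -/k -expr2 ler_wpM2l // exprn_ge0 // ltW.
apply: le_trans (ler_normB _ _) _; apply: le_trans (lerD e1 e2) _.
have m2 : 0 <= m ^+ 2 by apply: sqr_ge0.
have -> : (K * m) ^+ 2 * k ^+ 2 * (2 * k) + k ^+ 2 * (K * m ^+ 2)
   = (2 * k ^+ 3 * K ^+ 2 + K * k ^+ 2) * m ^+ 2 by ring.
rewrite ler_wpM2r //; lra.
Qed.

Lemma expands_ext f g d : f =1 g -> expands f d -> expands g d.
Proof. by move=> fg [K K0 H]; exists K => // v m ? ? ?; rewrite -fg; apply: H. Qed.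

End Dual.

(** * Reified rational expressions *)

Inductive expr := Cst of Q | Var of nat | Add of expr & expr
  | Mul of expr & expr | Inv of expr.

Fixpoint eval_dual (env : seq dual) e : dual :=
  match e with
  | Cst q => dcst q
  | Var i => nth (dcst Q0) env i
  | Add a b => dadd (eval_dual env a) (eval_dual env b)
  | Mul a b => dmul (eval_dual env a) (eval_dual env b)
  | Inv a => dinv (eval_dual env a)
  end.

Fixpoint regular (env : seq dual) e : bool :=
  match e with
  | Cst _ | Var _ => true
  | Add a b | Mul a b => regular env a && regular env b
  | Inv a => ~~ Qeq_bool (eval_dual env a).1 Q0 && regular env a
  end.

Section Eval.
Variable R : realFieldType.

Fixpoint eval (Y : nat -> R) e : R :=
  match e with
  | Cst q => qR R q
  | Var i => Y i
  | Add a b => eval Y a + eval Y b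
  | Mul a b => eval Y a * eval Y b
  | Inv a => (eval Y a)^-1
  end.

Definition env_expands (Y : (nat -> R) -> nat -> R) (env : seq dual) :=
  forall i, expands (fun v => Y v i) (nth (dcst Q0) env i).

Lemma eval_expands Y env e : env_expands Y env -> regular env e ->
  expands (fun v => eval (Y v) e) (eval_dual env e).
Proof.
move=> HY; elim: e => [q|i|a IHa b IHb|a IHa b IHb|a IHa] /=.
- by move=> _; apply: expands_cst.
- by move=> _; apply: HY.
- by case/andP=> /IHa ha /IHb hb; apply: expands_add.
- by case/andP=> /IHa ha /IHb hb; apply: expands_mul.
- by case/andP=> a0 /IHa ha; apply: expands_inv.
Qed.

End Eval.

(** * The ten-step base cycle *)

(** Row [i] is negative exactly on the columns [negs i]; row [10] is a perturbation. *)
Definition row_neg : seq (seq nat) :=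
  [:: [:: 0; 1]; [:: 0; 2]; [:: 0; 3]; [:: 0; 4]; [:: 1; 2]; [:: 1; 3];
      [:: 1; 4]; [:: 2; 3]; [:: 2; 4]; [:: 3; 4]; [:: 0]]%N.
Definition negs i := nth [::] row_neg i.
Definition neg i c := c \in negs i.

(** Found by computer search: with all [Y c = 1] and no extra weight these weights are
    reproduced, up to scale, by the ten AdaBoost steps of [pat], and the edge of the
    first step, [7/23], is the smallest of the ten. *)
Definition base_weight : seq Z :=
  [:: Zpos 201792089450644; Zpos 253030651319456; Zpos 59804833181380; Zpos 898751504747800;
      Zpos 465619579551820; Zpos 721510175750363; Zpos 32355910433847; Zpos 329975096376552;
      Zpos 597093643092068; Zpos 503531367356500].
Definition total_weight : Z := Zpos 4063464851260430.
Definition bw i := nth Z0 base_weight i.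

Definition pat : seq nat := [:: 0; 1; 2; 3; 0; 4; 3; 2; 1; 4]%N.

Definition ZQ (z : Z) : Q := Qmake z 1.

(** Row 10 has a single negative column; the factor [Var 5], which no step moves, gives it degree
    two like the other rows, so rescaling a state rescales all weights alike. [total_weight] is the
    sum of the ten base weights. *)
Definition coefE i := if (i < 10)%N then Cst (ZQ (bw i))
                      else Mul (Cst (ZQ total_weight)) (Var 5).
Definition weightE i := foldr (fun c e => Mul (Var c) e) (coefE i) (negs i).
Definition sumE (p : pred nat) :=
  foldr (fun i e => Add (weightE i) e) (Cst Q0) [seq i <- iota 0 11 | p i].
Definition posE c := sumE (fun i => ~~ neg i c).
Definition negE c := sumE (fun i => neg i c).
(** At edge [r] the update favours the rows negative on [c] by the ratio
    [(1 + r) / (1 - r) = posE c / negE c]; the normalisation is left out. *)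
Definition stepE c := Mul (Var c) (Mul (posE c) (Inv (negE c))).
Definition edgeE c := Mul (Add (posE c) (Mul (Cst (ZQ (Zneg 1))) (negE c)))
                          (Inv (Add (posE c) (negE c))).
(** Projective coordinates with [Var 4] scaled to 1: a cycle that reproduces the state up to scale
    becomes a fixed point at 0. *)
Definition outE j := if (j < 4)%N then Add (Mul (Var j) (Inv (Var 4))) (Cst (ZQ (Zneg 1)))
                     else Mul (Var 5) (Inv (Var 4)).

Definition env0 : seq dual :=
  [:: dvar Q1 0; dvar Q1 1; dvar Q1 2; dvar Q1 3; dcst Q1; dvar Q0 4].
Definition dstep env c := set_nth (dcst Q0) env c (eval_dual env (stepE c)).
Definition env t := foldl dstep env0 (take t pat).

Definition col t := nth 0%N pat t.
Definition out_dual j := eval_dual (env 10) (outE j).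
Definition bneck : Q := Qmake 7 23.
(** A rational between the bottleneck edge and the nine others: it separates a waiting factor from
    one in the middle of its cycle. *)
Definition gate : Q := Qmake 307 1000.
Definition bneck_grad := (eval_dual (env 0) (edgeE 0)).2.
Definition Lrow j := (out_dual j).2.

(** The eleven dual states, evaluated once and shared by all checks. *)
Definition envs := Eval vm_compute in env0 :: scanl dstep env0 pat.

Lemma nth_scanl_cons (S T : Type) (f : S -> T -> S) x d s t :
  (t <= size s)%N -> nth d (x :: scanl f x s) t = foldl f x (take t s).
Proof. by case: t => [|t] ts; rewrite ?take0 //= nth_scanl. Qed.

Lemma envsE : envs = env0 :: scanl dstep env0 pat.
Proof. by vm_cast_no_check (erefl envs). Qed.

Lemma envE t : (t < 11)%N -> nth [::] envs t = env t.
Proof. by move=> t11; rewrite envsE; apply: nth_scanl_cons. Qed.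

Definition cycle_check :=
  [&& all (fun t => regular (nth [::] envs t) (stepE (col t))) (iota 0 10),
      all (fun t => all (fun c => regular (nth [::] envs t) (edgeE c)) (iota 0 5)) (iota 0 10),
      all (fun j => regular (nth [::] envs 10) (outE j)) (iota 0 5),
      all (fun t => all (fun i => Qle_bool Q1 (nth (dcst Q0) (nth [::] envs t) i).1) (iota 0 5)) (iota 0 11),
      all (fun t => all (fun c => (c == col t) ||
             Qlt_b (eval_dual (nth [::] envs t) (edgeE c)).1
                   (eval_dual (nth [::] envs t) (edgeE (col t))).1) (iota 0 5)) (iota 0 10),
      all (fun t => Qlt_b gate (eval_dual (nth [::] envs t) (edgeE (col t))).1) (iota 1 9),
      Qeq_bool (eval_dual (nth [::] envs 0) (edgeE 0)).1 bneck,
      Qlt_b bneck gate &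
      all (fun j => Qeq_bool (eval_dual (nth [::] envs 10) (outE j)).1 Q0) (iota 0 5)].

Lemma cycle_checkT : cycle_check.
Proof. by vm_compute. Qed.

(** * States near the base cycle *)

Section LocalCycle.
Variable R : realFieldType.
Local Notation qR := (@qR R).

(** Closed under finite conjunctions, so that the many constants met along the cycle merge into
    one. *)
Definition large (A : R -> Prop) :=
  exists2 K : R, 0 < K & forall K', K <= K' -> A K'.

Lemma large_forall n (A : nat -> R -> Prop) :
  (forall k, (k < n)%N -> large (A k)) ->
  large (fun K => forall k, (k < n)%N -> A k K).
Proof.
elim: n => [|n IH] H; first by exists 1.
have [K K0 HK] := IH (fun k kn => H k (ltnW kn)).
have [K' K0' HK'] := H n (ltnSn n).
exists (K + K'); first by rewrite addr_gt0.
move=> L KL k; rewrite ltnS leq_eqVlt => /orP[/eqP ->|kn].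
  by apply: HK'; lra.
by apply: HK kn; lra.
Qed.

Lemma large_and (A B : R -> Prop) : large A -> large B ->
  large (fun K => A K /\ B K).
Proof.
move=> [K K0 HK] [K' K0' HK']; exists (K + K'); first by rewrite addr_gt0.
by move=> L KL; split; [apply: HK | apply: HK']; lra.
Qed.

Lemma large_imp (A B : R -> Prop) : (forall K, A K -> B K) -> large A -> large B.
Proof. by move=> AB [K K0 HK]; exists K => // L KL; apply/AB/HK. Qed.

Definition near_zero (P : R -> R -> (nat -> R) -> Prop) (K : R) :=
  forall v m, 0 <= m -> m * K <= 1 -> small v m -> P K m v.

Lemma expands_large f d : expands f d ->
  large (near_zero (fun K m v => `|f v - qR d.1 - lin d.2 v| <= K * m ^+ 2)).
Proof.
move=> [K K0 H]; exists K => // L KL v m m0 mL sv.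
have m2 : 0 <= m ^+ 2 by apply: sqr_ge0.
have mK : m * K <= 1 by apply: le_trans mL; rewrite ler_wpM2l.
by apply: le_trans (H v m m0 mK sv) _; rewrite ler_wpM2r.
Qed.

Lemma expands_lt f g a b : expands f a -> expands g b -> Qlt_b a.1 b.1 ->
  large (near_zero (fun K m v => f v < g v)).
Proof.
move=> /expandsW [K K0 H] /expandsW [K' K0' H'] /(@qR_lt R) ab.
set e := qR b.1 - qR a.1; have e0 : 0 < e by rewrite subr_gt0.
have i0 : 0 < e^-1 by rewrite invr_gt0.
have KK : 0 < (K + K') * e^-1 by rewrite mulr_gt0 ?addr_gt0.
exists (K + K' + 2 * ((K + K') * e^-1)); first by lra.
move=> L KL v m m0 mL sv.
have mK : m * K <= 1 by apply: le_trans mL; rewrite ler_wpM2l //; lra.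
have mK' : m * K' <= 1 by apply: le_trans mL; rewrite ler_wpM2l //; lra.
have [_ h1] := H v m m0 mK sv.
have [_ h2] := H' v m m0 mK' sv.
have h3 : m * (2 * ((K + K') * e^-1)) <= 1.
  by apply: le_trans mL; rewrite ler_wpM2l //; lra.
have h4 : 2 * (m * (K + K')) <= e.
  rewrite -[X in _ <= X]mul1r -ler_pdivrMr //.
  by apply: le_trans h3; rewrite le_eqVlt; apply/orP; left; apply/eqP; ring.
move: h1 h2 h4; rewrite !ler_norml /e => /andP[_ h1] /andP[h2 _] h4.
have [m00|mn] := eqVneq m 0; first by move: h1 h2; rewrite m00; lra.
have m1 : 0 < m by rewrite lt0r mn.
nra.
Qed.

Definition step (Y : nat -> R) c : nat -> R :=
  fun i => if i == c then eval Y (stepE c) else Y i.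
Definition start (v : nat -> R) : nat -> R :=
  fun i => if (i < 4)%N then 1 + v i else
           if i == 4%N then 1 else if i == 5%N then v 4%N else 0.
Definition run t v := foldl step (start v) (take t pat).

Lemma run_recr t v : (t < 10)%N -> run t.+1 v = step (run t v) (col t).
Proof. by move=> t10; rewrite /run (take_nth 0%N) // -cats1 foldl_cat. Qed.

Lemma env_0 : env 0 = env0.
Proof. by []. Qed.

Lemma env_recr t : (t < 10)%N -> env t.+1 = dstep (env t) (col t).
Proof. by move=> t10; rewrite /env (take_nth 0%N) // -cats1 foldl_cat. Qed.

Lemma env0_expands : env_expands start env0.
Proof.
have var q k : (k < 5)%N -> expands (fun v : nat -> R => qR q + v k) (dvar q k).
  exact: expands_var.
move=> [|[|[|[|[|[|i]]]]]]; rewrite /start /=.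
- by apply: expands_ext (var Q1 0%N isT) => v; rewrite qR1.
- by apply: expands_ext (var Q1 1%N isT) => v; rewrite qR1.
- by apply: expands_ext (var Q1 2%N isT) => v; rewrite qR1.
- by apply: expands_ext (var Q1 3%N isT) => v; rewrite qR1.
- by apply: expands_ext (expands_cst _ Q1) => v; rewrite qR1.
- by apply: expands_ext (var Q0 4%N isT) => v; rewrite qR0 add0r.
- by rewrite nth_nil; apply: expands_ext (expands_cst _ Q0) => v; rewrite qR0.
Qed.

Lemma col_lt t : (t < 10)%N -> (col t < 5)%N.
Proof.
move=> t10; have /allP : all (fun c => c < 5)%N pat by [].
by apply; apply: mem_nth.
Qed.

#[local] Opaque eval_dual regular env envs.

Lemma cycle_check_split : [/\
  forall t, (t < 10)%N -> regular (env t) (stepE (col t)),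
  forall t c, (t < 10)%N -> (c < 5)%N -> regular (env t) (edgeE c),
  forall j, (j < 5)%N -> regular (env 10) (outE j),
  forall t i, (t < 11)%N -> (i < 5)%N -> Qle_bool Q1 (nth (dcst Q0) (env t) i).1 &
  [/\ forall t c, (t < 10)%N -> (c < 5)%N -> c != col t ->
       Qlt_b (eval_dual (env t) (edgeE c)).1 (eval_dual (env t) (edgeE (col t))).1,
      forall t, (0 < t < 10)%N -> Qlt_b gate (eval_dual (env t) (edgeE (col t))).1,
      Qeq_bool (eval_dual (env 0) (edgeE 0)).1 bneck,
      Qlt_b bneck gate &
      forall j, (j < 5)%N -> Qeq_bool (eval_dual (env 10) (outE j)).1 Q0]].
Proof.
have it a n t : (t \in iota a n) = (a <= t < a + n)%N by rewrite mem_iota.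
have := cycle_checkT; rewrite /cycle_check.
move=> /and5P[/allP c1 /allP c2 /allP c3 /allP c4 /and5P[/allP c5 /allP c6 c7 c8 /allP c9]].
split.
- move=> t t10; rewrite -(envE (leqW t10)); apply: c1.
  by rewrite it.
- move=> t c t10 c5'; rewrite -(envE (leqW t10)).
  have /allP := c2 t (etrans (it 0%N 10%N t) t10); apply.
  by rewrite it.
- move=> j j5; rewrite -(@envE 10 isT); apply: c3.
  by rewrite it.
- move=> t i t11 i5; rewrite -(envE t11).
  have /allP := c4 t (etrans (it 0%N 11%N t) t11); apply.
  by rewrite it.
split.
- move=> t c t10 c5' cc; rewrite -(envE (leqW t10)).
  have /allP /(_ c) := c5 t (etrans (it 0%N 10%N t) t10).
  rewrite it c5' (negPf cc) => /(_ isT); exact.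
- move=> t /andP[t0 t10]; rewrite -(envE (leqW t10)); apply: c6.
  by rewrite it t0.
- rewrite -(@envE 0%N isT); exact: c7.
- exact: c8.
- move=> j j5; rewrite -(@envE 10 isT); apply: c9.
  by rewrite it.
Qed.

Lemma run_expands t : (t <= 10)%N -> env_expands (run t) (env t).
Proof.
elim: t => [|t IH] t10; first by rewrite env_0; apply: env0_expands.
have He := IH (ltnW t10); have [reg _ _ _ _] := cycle_check_split.
move=> i; rewrite env_recr // /dstep nth_set_nth /=.
have [->|ic] := eqVneq i (col t).
  apply: expands_ext (eval_expands He (reg t t10)) => v.
  by rewrite run_recr // /step eqxx.
by apply: expands_ext (He i) => v; rewrite run_recr // /step (negPf ic).
Qed.

Definition edge_at t c v := eval (run t v) (edgeE c).
Definition out_at j v := eval (run 10 v) (outE j).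

(** The strict comparisons are checked exactly at the base point and persist for small deviations.
    The equalities there, for the bottleneck edge and the outputs, leave the linear part as leading
    term. *)
Theorem local_cycle : exists2 K : R, 0 < K & near_zero (fun K m v =>
  [/\ forall t i, (t < 11)%N -> (i < 5)%N -> 0 < run t v i,
      forall t c, (t < 10)%N -> (c < 5)%N -> c != col t ->
        edge_at t c v < edge_at t (col t) v,
      (forall t, (0 < t < 10)%N -> qR gate < edge_at t (col t) v) /\
        edge_at 0 0 v < qR gate,
      `|edge_at 0 0 v - qR bneck - lin bneck_grad v| <= K * m ^+ 2 &
      forall j, (j < 5)%N -> `|out_at j v - lin (Lrow j) v| <= K * m ^+ 2]) K.
Proof.
have [regS regE regO val [gap gt eq0 bg out0]] := cycle_check_split.
have Edge t c (t10 : (t < 10)%N) (c5 : (c < 5)%N) :=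
  eval_expands (run_expands (ltnW t10)) (regE t c t10 c5).
have Out j (j5 : (j < 5)%N) := eval_expands (run_expands (leqnn 10)) (regO j j5).
have Gate := expands_cst R gate.
have h1 : large (fun K => forall t, (t < 11)%N -> forall i, (i < 5)%N ->
    near_zero (fun K m v => 0 < run t v i) K).
  apply: large_forall => t t11; apply: large_forall => i i5.
  have := expands_lt (expands_cst R Q0) (run_expands t11 i).
  rewrite qR0; apply; apply/negP => /Qle_bool_iff h.
  have /Qle_bool_iff h' := val t i t11 i5.
  have e : Qle_bool Q1 Q0 = true by apply/Qle_bool_iff/(Qle_trans _ _ _ h' h).
  discriminate e.
have h2 : large (fun K => forall t, (t < 10)%N -> forall c, (c < 5)%N ->
    c != col t -> near_zero (fun K m v => edge_at t c v < edge_at t (col t) v) K).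
  apply: large_forall => t t10; apply: large_forall => c c5.
  have [->|cc] := eqVneq c (col t); first by exists 1.
  apply: large_imp (expands_lt (Edge t c t10 c5) (Edge t _ t10 (col_lt t10)) _).
    by move=> K HK _.
  exact: gap.
have h3 : large (fun K => forall t, (t < 10)%N -> (0 < t)%N ->
    near_zero (fun K m v => qR gate < edge_at t (col t) v) K).
  apply: large_forall => t t10; case: (posnP t) => [->|t0]; first by exists 1.
  apply: large_imp (expands_lt Gate (Edge t _ t10 (col_lt t10)) _).
    by move=> K HK _.
  by apply: gt; rewrite t0.
have h4 : large (near_zero (fun K m v => edge_at 0 0 v < qR gate)).
  apply: expands_lt (Edge 0 0 isT isT)%N Gate _.
  apply/negP => /Qle_bool_iff h; move/negP: bg; apply; apply/Qle_bool_iff.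
  by apply: Qle_trans h _; move/Qeq_bool_iff: eq0 => ->; apply: Qle_refl.
have h5 := expands_large (Edge 0 0 isT isT)%N.
have h6 : large (fun K => forall j, (j < 5)%N -> near_zero (fun K m v =>
    `|out_at j v - qR (out_dual j).1 - lin (Lrow j) v| <= K * m ^+ 2) K).
  by apply: large_forall => j j5; apply: expands_large (Out j j5).
have [K K0 HK] := large_and h1 (large_and h2 (large_and h3 (large_and h4 (large_and h5 h6)))).
exists K; first exact: K0.
move=> v m m0 mK sv.
have [H1 [H2 [H3 [H4 [H5 H6]]]]] := HK K (lexx K).
split.
- move=> t i t11 i5; exact: (H1 t t11 i i5 v m m0 mK sv).
- move=> t c t10 c5 cc; exact: (H2 t t10 c c5 cc v m m0 mK sv).
- split; last exact: (H4 v m m0 mK sv).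
  move=> t /andP[t0 t10]; exact: (H3 t t10 t0 v m m0 mK sv).
- have := H5 v m m0 mK sv; rewrite (qR_eq R (Qeq_bool_eq _ _ eq0)); exact.
- move=> j j5; have := H6 j j5 v m m0 mK sv.
  rewrite (qR_eq R (Qeq_bool_eq _ _ (out0 j j5))) qR0 subr0; exact.
Qed.

End LocalCycle.

(** * Invariant cones *)

(** The Jacobian, at the base cycle, of the ten-step return map in projective coordinates. *)
Definition Lrows := Eval vm_compute in
  mkseq (fun j => (eval_dual (nth [::] envs 10) (outE j)).2) 5.
Definition dev_grad := Eval vm_compute in (eval_dual (nth [::] envs 0) (edgeE 0)).2.

Lemma LrowsE : Lrows = mkseq (fun j => (eval_dual (nth [::] envs 10) (outE j)).2) 5.
Proof. by vm_cast_no_check (erefl Lrows). Qed.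

Lemma dev_gradE : dev_grad = bneck_grad.
Proof.
rewrite /bneck_grad -(@envE 0%N isT).
by vm_cast_no_check (erefl dev_grad).
Qed.

Lemma LrowE j : (j < 5)%N -> Lrow j = nth [::] Lrows j.
Proof.
by move=> j5; rewrite /Lrow /out_dual -(@envE 10 isT) LrowsE (nth_mkseq [::] _ j5).
Qed.

Definition qsum (s : seq Q) := foldr (fun x y => Qred (Qplus x y)) Q0 s.
Definition qdot (l a : seq Q) := qsum (mkseq (fun k => Qmult (gr l k) (gr a k)) 5).
Definition qadot (l r : seq Q) := qsum (mkseq (fun k => Qmult (Qabs (gr l k)) (gr r k)) 5).

Section Cone.
Variable R : realFieldType.
Local Notation qR := (@qR R).

Definition cone (a r : seq Q) (h : R) (v : nat -> R) :=
  forall k, (k < 5)%N -> `|v k - h * qR (gr a k)| <= h * qR (gr r k).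

Lemma qR_sum (f : nat -> Q) n :
  qR (qsum (mkseq f n)) = \sum_(k < n) qR (f k).
Proof.
rewrite /mkseq -(big_mkord xpredT (fun k => qR (f k))) /index_iota subn0.
elim: (iota 0 n) => [|k s IH] /=; first by rewrite big_nil qR0.
by rewrite big_cons qR_red qR_add IH.
Qed.

Lemma lin_cone l a r h v : cone a r h v ->
  `|lin l v - h * qR (qdot l a)| <= h * qR (qadot l r).
Proof.
move=> cv; rewrite /qdot /qadot !qR_sum !mulr_sumr /lin -sumrB.
apply: le_trans (ler_norm_sum _ _ _) _; apply: ler_sum => k _.
rewrite !qR_mul qR_abs.
have -> : qR (gr l k) * v k - h * (qR (gr l k) * qR (gr a k)) =
          qR (gr l k) * (v k - h * qR (gr a k)) by ring.
by rewrite normrM [X in _ <= X]mulrCA ler_wpM2l // cv.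
Qed.

Lemma lin_sub_scale (l l' : seq Q) c v :
  lin (mkseq (fun k => Qplus (gr l k) (Qopp (Qmult c (gr l' k)))) 5) v =
  lin l v - qR c * lin l' v.
Proof.
rewrite lin_mkseq /lin mulr_sumr -sumrB; apply: eq_bigr => k _.
by rewrite qR_add qR_opp qR_mul; ring.
Qed.

End Cone.

(** The parameters: [p] is the coordinate measuring the size [h] of the
    deviation, [s] its sign, and [ks] lists the coordinates contracted into
    the cone; coordinates outside [ks] are on the axis exactly. *)
Record cone_data := ConeData {
  cn_a : seq Q; cn_r : seq Q; cn_p : nat; cn_s : Q; cn_ks : seq nat;
  cn_lo : Q; cn_hi : Q; cn_M : Q; cn_c : Q; cn_C : Q }.

(** To first order [sl] yields the new size [h'], and [l k] the offset of coordinate [k] from the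
    new axis point [h' * a_k]. Keeping that offset below [lo * r_k] makes the Jacobian map the cone
    strictly inside itself, and the slack pays for the quadratic error. The last two tests make the
    bottleneck excess comparable to [h]. *)
Definition cone_ok (C : cone_data) :=
  let L k := nth [::] Lrows k in
  let a := cn_a C in let r := cn_r C in let p := cn_p C in let s := cn_s C in
  let sl := mkseq (fun k => Qmult s (gr (L p) k)) 5 in
  let l k := mkseq (fun i => Qplus (gr (L k) i) (Qopp (Qmult (gr a k) (gr sl i)))) 5 in
  [&& (p < 5)%N,
      Qeq_bool (Qmult s s) Q1 && Qeq_bool (gr a p) s && Qeq_bool (gr r p) Q0,
      Qlt_b Q0 (cn_lo C) && Qlt_b (cn_hi C) (Qmake 1 2),
      Qlt_b (cn_lo C) (Qplus (qdot sl a) (Qopp (qadot sl r))) &&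
        Qlt_b (Qplus (qdot sl a) (qadot sl r)) (cn_hi C),
      all (fun k => Qlt_b (Qplus (Qabs (qdot (l k) a)) (qadot (l k) r))
                          (Qmult (cn_lo C) (gr r k))) (cn_ks C),
      all (fun k => [|| k \in cn_ks C, k == p |
                        Qeq_bool (gr a k) Q0 && Qeq_bool (gr r k) Q0]) (iota 0 5),
      all (fun k => Qle_bool (Qplus (Qabs (gr a k)) (gr r k)) (cn_M C)) (iota 0 5),
      Qlt_b Q0 (cn_M C) && Qlt_b Q0 (cn_c C) &
      Qlt_b (cn_c C) (Qplus (qdot dev_grad a) (Qopp (qadot dev_grad r))) &&
      Qlt_b (Qplus (qdot dev_grad a) (qadot dev_grad r)) (cn_C C)].

Definition qn (n d : positive) := Qmake (Zpos n) d.
(** A cone around an eigenvector for 1/5, normalised by the perturbation coordinate. The axis is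
    integral so that integer initial states can lie on it. *)
Definition coneA := ConeData
  [:: Qmake (Zneg 38) 1; qn 1 1; Qmake (Zneg 1) 1; Qmake (Zneg 32) 1; qn 1 1]
  [:: qn 2 1; qn 1 1; qn 1 1; qn 1 1; Q0] 4 Q1 [:: 0; 1; 2; 3]%N
  (qn 19 100) (qn 21 100) (qn 40 1) (qn 9 10) (qn 10 1).
(** A cone in the hyperplane without perturbation, around the eigenvector whose eigenvalue lies
    between [cn_lo] and [cn_hi]; coordinate 3 is negative there. *)
Definition coneB := ConeData
  [:: Qmake (Zneg 13) 20; qn 5 24; qn 1 6; Qmake (Zneg 1) 1; Q0]
  [:: qn 1 40; qn 1 40; qn 1 40; Q0; Q0] 3 (Qmake (Zneg 1) 1) [:: 0; 1; 2]%N
  (qn 14 100) (qn 15 100) (qn 1 1) (qn 1 20) (qn 1 1).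

Lemma coneA_ok : cone_ok coneA. Proof. by vm_compute. Qed.
Lemma coneB_ok : cone_ok coneB. Proof. by vm_compute. Qed.

Section ConeStep.
Variable R : realFieldType.
Local Notation qR := (@qR R).
Implicit Types (v : nat -> R) (h : R).

Definition next v : nat -> R := fun j => out_at j v.

Definition tracks_cycle v :=
  [/\ forall t i, (t < 11)%N -> (i < 5)%N -> 0 < run t v i,
      forall t c, (t < 10)%N -> (c < 5)%N -> c != col t ->
        edge_at t c v < edge_at t (col t) v,
      forall t, (0 < t < 10)%N -> qR gate < edge_at t (col t) v &
      edge_at 0 0 v < qR gate].

Lemma cone_step (C : cone_data) : cone_ok C ->
  exists2 h0 : R, 0 < h0 & exists2 K : R, 0 < K & forall h v, 0 < h -> h <= h0 ->
  cone (cn_a C) (cn_r C) h v ->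
  (forall k, (k < 5)%N -> k \notin cn_ks C -> k != cn_p C -> next v k = 0) ->
  let h' := qR (cn_s C) * next v (cn_p C) in
  [/\ tracks_cycle v, cone (cn_a C) (cn_r C) h' (next v),
      qR (cn_lo C) * h <= h' <= qR (cn_hi C) * h,
      qR (cn_c C) * h <= edge_at 0 0 v - qR bneck <= qR (cn_C C) * h &
      forall j, (j < 5)%N -> `|next v j - lin (nth [::] Lrows j) v| <= K * h ^+ 2].
Proof.
case: C => a r p s ks lo hi M c C'; rewrite /cone_ok.
cbv beta iota zeta delta [cn_a cn_r cn_p cn_s cn_ks cn_lo cn_hi cn_M cn_c cn_C].
move=> /and5P[p5 /andP[/andP[ss ap] rp] /andP[lo0 hi2] /andP[lo1 hi1] /and5P[kin kout kM]].
move=> /andP[M0 c0] /andP[c1 C1].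
have [K K0 HK] := local_cycle R.
set sl := mkseq (fun k => Qmult s (gr (nth [::] Lrows p) k)) 5.
set l := fun k => mkseq (fun i => Qplus (gr (nth [::] Lrows k) i)
                      (Qopp (Qmult (gr a k) (gr sl i)))) 5.
have M0' : 0 < qR M by rewrite -(qR0 R); apply: qR_lt.
have lo0' : 0 < qR lo by rewrite -(qR0 R); apply: qR_lt.
(* [e] is a common slack in all strict inequalities of the certificate. *)
have [e e0 He] : exists2 e : R, 0 < e & [/\ qR lo + e <= qR (qdot sl a) - qR (qadot sl r),
   qR (qdot sl a) + qR (qadot sl r) + e <= qR hi,
   (forall k, k \in ks -> `|qR (qdot (l k) a)| + qR (qadot (l k) r) + e <= qR lo * qR (gr r k)),
   qR c + e <= qR (qdot dev_grad a) - qR (qadot dev_grad r) &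
   qR (qdot dev_grad a) + qR (qadot dev_grad r) + e <= qR C'].
  have hk : exists2 e : R, 0 < e & forall k, k \in ks ->
      `|qR (qdot (l k) a)| + qR (qadot (l k) r) + e <= qR lo * qR (gr r k).
    elim: (ks) kin => [|k ks' IH] /=; first by exists 1.
    move=> /andP[hk /IH [e e0 He]].
    move/(@qR_lt R): hk; rewrite qR_add qR_abs qR_mul -/(l k) => hk.
    set x := `|_| + _ in hk.
    exists (Num.min e (qR lo * qR (gr r k) - x)); first by rewrite lt_min e0 subr_gt0.
    move=> i; rewrite inE => /orP[/eqP ->|/He h].
      by rewrite -/x -lerBrDl ge_min lexx orbT.
    by apply: le_trans h; rewrite lerD2l ge_min lexx.
  have [e e0 He] := hk.
  move/(@qR_lt R): lo1; rewrite qR_add qR_opp -/sl => lo1.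
  move/(@qR_lt R): hi1; rewrite qR_add -/sl => hi1.
  move/(@qR_lt R): c1; rewrite qR_add qR_opp => c1.
  move/(@qR_lt R): C1; rewrite qR_add => C1.
  set x1 := qR (qdot sl a) - _ in lo1 *; set x2 := qR (qdot sl a) + _ in hi1 *.
  set x3 := qR (qdot dev_grad a) - _ in c1 *; set x4 := qR (qdot dev_grad a) + _ in C1 *.
  exists (Num.min e (Num.min (Num.min (x1 - qR lo) (qR hi - x2))
                             (Num.min (x3 - qR c) (qR C' - x4)))).
    by rewrite !lt_min e0 !subr_gt0 lo1 hi1 c1 C1.
  split.
  - by rewrite -lerBrDl !ge_min lexx /= ?orbT.
  - by rewrite -lerBrDl !ge_min lexx /= ?orbT.
  - by move=> k /He h; apply: le_trans h; rewrite lerD2l ge_min lexx.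
  - by rewrite -lerBrDl !ge_min lexx /= ?orbT.
  - by rewrite -lerBrDl !ge_min lexx /= ?orbT.
case: He => e1 e2 e3 e4 e5.
(* Both [next v k] and [h' * a_k] carry a quadratic error, together at most [1 + |a_k|] times
   [K1 * h ^+ 2]. *)
set B : R := 1 + \sum_(k < 5) `|qR (gr a k)|.
have B1 : 1 <= B by rewrite lerDl sumr_ge0.
have aB k : (k < 5)%N -> `|qR (gr a k)| <= B - 1.
  move=> k5; rewrite /B addrAC subrr add0r (bigD1 (Ordinal k5)) //=.
  by rewrite lerDl sumr_ge0.
set K1 := K * qR M ^+ 2; have K10 : 0 < K1 by rewrite mulr_gt0 ?exprn_gt0.
have Kq : 0 < K1 * B by rewrite mulr_gt0 //; lra.
(* The first bound puts [h * qR M] within the radius [1 / K] of [local_cycle]; the second makes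
   [K1 * h ^+ 2 * B] at most the slack [e * h]. *)
exists (Num.min ((qR M)^-1 * K^-1) (e * (K1 * B)^-1)).
  by rewrite lt_min !mulr_gt0 ?invr_gt0.
exists K1 => // h v h0; rewrite le_min => /andP[hK he] cv out0; set h' := qR s * next v p.
have he' : h * (K1 * B) <= e by rewrite -ler_pdivlMr // .
have hM0 : 0 <= h * qR M by rewrite mulr_ge0 // ltW.
have hMK : h * qR M * K <= 1.
  have MK0 : 0 < qR M * K by rewrite mulr_gt0.
  have := ler_wpM2r (ltW MK0) hK.
  by rewrite -invfM mulVf ?lt0r_neq0 // mulrA.
have sv : small v (h * qR M).
  move=> k k5; have := cv k k5; have := allP kM k; rewrite mem_iota k5 => /(_ isT).
  move=> /(@qR_le R); rewrite qR_add qR_abs => hM hv.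
  have -> : v k = (v k - h * qR (gr a k)) + h * qR (gr a k) by ring.
  apply: le_trans (ler_normD _ _) _; rewrite normrM (gtr0_norm h0).
  apply: le_trans (lerD hv (lexx _)) _.
  by rewrite -mulrDr ler_pM2l // addrC.
have [H1 H2 [H3 H4] H5 H6] := HK v _ hM0 hMK sv.
have sqM : K * (h * qR M) ^+ 2 = K1 * h ^+ 2 by rewrite /K1; ring.
rewrite sqM in H5 H6.
have H6' j : (j < 5)%N -> `|next v j - lin (nth [::] Lrows j) v| <= K1 * h ^+ 2.
  by move=> j5; have := H6 j j5; rewrite LrowE.
have small2 : K1 * h ^+ 2 * B <= e * h.
  by have -> : K1 * h ^+ 2 * B = h * (K1 * B) * h; [ring | rewrite ler_wpM2r // ltW].
have small1 : K1 * h ^+ 2 <= e * h.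
  apply: le_trans small2; rewrite -[X in X <= _]mulr1 ler_wpM2l //.
  by rewrite mulr_ge0 ?sqr_ge0 // ltW.
have s1 : `|qR s| = 1.
  have : qR s * qR s = 1 by rewrite -qR_mul -(qR1 R); apply: qR_eq; apply: Qeq_bool_eq.
  by move=> /(congr1 Num.norm); rewrite normrM normr1 -expr2 => /eqP; rewrite sqrp_eq1 // => /eqP.
have linsl : lin sl v = qR s * lin (nth [::] Lrows p) v.
  by rewrite lin_mkseq mulr_sumr; apply: eq_bigr => k _; rewrite qR_mul mulrA.
have h'E : `|h' - lin sl v| <= K1 * h ^+ 2.
  by rewrite linsl /h' -mulrBr normrM s1 mul1r H6'.
have [hlo hhi] : qR lo * h <= h' /\ h' <= qR hi * h.
  have := lin_cone sl cv; move: h'E; rewrite !ler_norml => /andP[u1 u2] /andP[u3 u4].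
  by split; nra.
have h'0 : 0 < h' by apply: lt_le_trans hlo; rewrite mulr_gt0.
split=> //; last 2 first.
- by rewrite hlo hhi.
- have := lin_cone dev_grad cv; move: H5; rewrite -dev_gradE !ler_norml.
  move=> /andP[u1 u2] /andP[u3 u4]; apply/andP; split; nra.
move=> k k5; have [ks_k|nks] := boolP (k \in ks).
  have hl := lin_cone (l k) cv.
  have lE : lin (l k) v = lin (nth [::] Lrows k) v - qR (gr a k) * lin sl v.
    by rewrite lin_sub_scale.
  have -> : next v k - h' * qR (gr a k) = (next v k - lin (nth [::] Lrows k) v)
     + (- qR (gr a k) * (h' - lin sl v)) + (lin (l k) v - h * qR (qdot (l k) a))
     + h * qR (qdot (l k) a) by rewrite lE; ring.
  apply: le_trans (ler_normD _ _) _.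
  apply: (@le_trans _ _ (K1 * h ^+ 2 + (B - 1) * (K1 * h ^+ 2) + h * qR (qadot (l k) r)
                         + h * `|qR (qdot (l k) a)|)).
    apply: lerD; last by rewrite normrM (gtr0_norm h0).
    apply: le_trans (ler_normD _ _) _; apply: lerD => //.
    apply: le_trans (ler_normD _ _) _; apply: lerD; first exact: H6'.
    by rewrite normrM normrN ler_pM // aB.
  have -> : K1 * h ^+ 2 + (B - 1) * (K1 * h ^+ 2) = K1 * h ^+ 2 * B by ring.
  have := e3 k ks_k; move: hlo small2.
  have r0 : 0 <= qR (gr r k).
    have := cv k k5; move=> /(le_trans (normr_ge0 _)); rewrite pmulr_rge0 //.
  move=> hlo sm hk.
  apply: (@le_trans _ _ (qR lo * h * qR (gr r k))); last by rewrite ler_wpM2r.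
  set x := qR (qadot _ _) in hk *; set y := `|_| in hk *; nra.
have [->|kp] := eqVneq k p.
  rewrite (qR_eq R (Qeq_bool_eq _ _ ap)) (qR_eq R (Qeq_bool_eq _ _ rp)) qR0 mulr0.
  have ss1 : qR s * qR s = 1 by rewrite -qR_mul -(qR1 R); apply: qR_eq; apply: Qeq_bool_eq.
  by rewrite /h' mulrAC ss1 mul1r subrr normr0.
have := allP kout k; rewrite mem_iota k5 (negPf nks) (negPf kp) /= => /(_ isT) /andP[a0 r0].
rewrite (qR_eq R (Qeq_bool_eq _ _ a0)) (qR_eq R (Qeq_bool_eq _ _ r0)) qR0 !mulr0 subr0.
by rewrite out0 // normr0.
Qed.

End ConeStep.

(** * The two decay rates *)

Definition Lij i j := gr (nth [::] Lrows i) j.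
Definition minor2 i j := Qplus (Qmult (Lij i i) (Lij j j)) (Qopp (Qmult (Lij i j) (Lij j i))).
(** [cub2], [cub1], [cub0] are the coefficients of the characteristic polynomial of the Jacobian
    block on coordinates 1, 2, 3. *)
Definition cub2 := Qred (Qopp (Qplus (Lij 1 1) (Qplus (Lij 2 2) (Lij 3 3)))).
Definition cub1 := Qred (Qplus (minor2 1 2) (Qplus (minor2 1 3) (minor2 2 3))).
Definition cub0 := Qred (Qopp (Qplus (Qmult (Lij 1 1) (minor2 2 3))
  (Qplus (Qopp (Qmult (Lij 1 2) (Qplus (Qmult (Lij 2 1) (Lij 3 3)) (Qopp (Qmult (Lij 2 3) (Lij 3 1))))))
         (Qmult (Lij 1 3) (Qplus (Qmult (Lij 2 1) (Lij 3 2)) (Qopp (Qmult (Lij 2 2) (Lij 3 1)))))))).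
Definition cubQ x := Qplus (Qmult x (Qmult x x))
  (Qplus (Qmult cub2 (Qmult x x)) (Qplus (Qmult cub1 x) cub0)).

Definition cub_signs :=
  [&& Qlt_b (cubQ (qn 14 100)) Q0, Qlt_b Q0 (cubQ (qn 15 100)),
      Qlt_b Q0 (cubQ (qn 1 100)) & Qlt_b (cubQ (qn 2 100)) Q0].
Lemma cub_signsT : cub_signs. Proof. by vm_compute. Qed.

Definition cubic_form (A B C D a b : Z) :=
  Z.add (Z.mul A (Z.mul a (Z.mul a a))) (Z.add (Z.mul B (Z.mul a (Z.mul a b)))
    (Z.add (Z.mul C (Z.mul a (Z.mul b b))) (Z.mul D (Z.mul b (Z.mul b b))))).

(** The characteristic polynomial, cleared of denominators and read modulo 43,
    has no zero on the projective line. *)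
Definition cub_mod43 :=
  let n2 := Qnum cub2 in let n1 := Qnum cub1 in let n0 := Qnum cub0 in
  let d2 := Zpos (Qden cub2) in let d1 := Zpos (Qden cub1) in let d0 := Zpos (Qden cub0) in
  let md z := Z.modulo z (Zpos 43) in
  let A := md (Z.mul d2 (Z.mul d1 d0)) in let B := md (Z.mul n2 (Z.mul d1 d0)) in
  let C := md (Z.mul n1 (Z.mul d2 d0)) in let D := md (Z.mul n0 (Z.mul d2 d1)) in
  all (fun a => all (fun b => [|| (a == 0%N) && (b == 0%N) |
     ~~ Z.eqb (md (cubic_form A B C D (Z.of_nat a) (Z.of_nat b))) Z0])
     (iota 0 43)) (iota 0 43).
Lemma cub_mod43T : cub_mod43. Proof. by vm_compute. Qed.

(** Coordinate 0 is forgotten because the first step uses column 0 and [Neg] is proportional to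
    [Y 0], so the updated [Y 0] does not depend on the old one. Row 4 reduces to its diagonal entry
    because [Y 5] is constant and vanishes at the base point, while [Y 4] grows fivefold per
    cycle. *)
Definition L_bounds :=
  [&& Qle_bool (Qabs (Lij 1 1)) (qn 1 500), Qle_bool (Qabs (Lij 1 2)) (qn 1 100),
      Qle_bool (Qabs (Lij 2 1)) (qn 1 200), Qle_bool (Qabs (Lij 2 2)) (qn 1 100) &
  [&& Qle_bool (Qabs (Lij 3 1)) (qn 1 40), Qle_bool (Qabs (Lij 3 2)) (qn 1 500),
      all (fun i => Qeq_bool (Lij i 0) Q0) [:: 1; 2; 3; 4]%N,
      all (fun i => Qeq_bool (Lij 4 i) Q0) [:: 1; 2; 3]%N & Qeq_bool (Lij 4 4) (qn 1 5)]].
Lemma L_boundsT : L_bounds. Proof. by vm_compute. Qed.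

Lemma lin_Lrow (F : realFieldType) j (v : nat -> F) : lin (nth [::] Lrows j) v =
  qR F (Lij j 0) * v 0%N + qR F (Lij j 1) * v 1%N + qR F (Lij j 2) * v 2%N
  + qR F (Lij j 3) * v 3%N + qR F (Lij j 4) * v 4%N.
Proof.
rewrite /lin /Lij; move: (nth _ _ _) => l.
by rewrite !big_ord_recl big_ord0 /= addr0 !addrA.
Qed.

#[local] Opaque Lij.

Lemma cub_coefE (F : realFieldType) (l := fun i j => qR F (Lij i j)) : [/\ qR F cub2 = - (l 1 1 + (l 2 2 + l 3 3)),
  qR F cub1 = (l 1 1 * l 2 2 - l 1 2 * l 2 1) + ((l 1 1 * l 3 3 - l 1 3 * l 3 1)
     + (l 2 2 * l 3 3 - l 2 3 * l 3 2)) &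
  qR F cub0 = - (l 1 1 * (l 2 2 * l 3 3 - l 2 3 * l 3 2)
     + (- (l 1 2 * (l 2 1 * l 3 3 - l 2 3 * l 3 1))
     + l 1 3 * (l 2 1 * l 3 2 - l 2 2 * l 3 1)))].
Proof.
rewrite /l /cub2 /cub1 /cub0 /minor2.
move: (Lij 1 1) (Lij 1 2) (Lij 1 3) (Lij 2 1) (Lij 2 2) (Lij 2 3) (Lij 3 1) (Lij 3 2)
  (Lij 3 3); clear l => a b c d e f g h i.
by split; rewrite qR_red !(qR_opp, qR_add, qR_mul).
Qed.

#[local] Opaque Lrows dev_grad envs Lij cub2 cub1 cub0.

Lemma cubic_form_mod (a b A B C D : Z) (md := fun z => Z.modulo z 43) :
  cubic_form A B C D a b = Z0 ->
  md (cubic_form (md A) (md B) (md C) (md D) (md a) (md b)) = Z0.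
Proof.
move=> h; rewrite /md.
suff : eqm 43 (cubic_form (md A) (md B) (md C) (md D) (md a) (md b))
              (cubic_form A B C D a b) by rewrite h.
rewrite /cubic_form /md.
by repeat first [exact: Zmod_eqm | apply: Zplus_eqm | apply: Zmult_eqm].
Qed.

Lemma cubic_form_zero (A B C D a b : Z) :
  all (fun i => all (fun j => [|| (i == 0%N) && (j == 0%N) |
     ~~ Z.eqb (Z.modulo (cubic_form (Z.modulo A 43) (Z.modulo B 43) (Z.modulo C 43)
        (Z.modulo D 43) (Z.of_nat i) (Z.of_nat j)) 43) Z0]) (iota 0 43)) (iota 0 43) ->
  cubic_form A B C D a b = Z0 -> Z.modulo a 43 = Z0 /\ Z.modulo b 43 = Z0.
Proof.
move=> /allP chk /cubic_form_mod.
have [ha hb] := (Z.mod_pos_bound a 43 (erefl Lt), Z.mod_pos_bound b 43 (erefl Lt)).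
have [i [i43 ->]] : exists i, (i < 43)%N /\ Z.modulo a 43 = Z.of_nat i.
  by exists (Z.to_nat (Z.modulo a 43)); lia.
have [j [j43 ->]] : exists j, (j < 43)%N /\ Z.modulo b 43 = Z.of_nat j.
  by exists (Z.to_nat (Z.modulo b 43)); lia.
have := chk i; rewrite mem_iota i43 => /(_ isT) /allP /(_ j).
rewrite mem_iota j43 => /(_ isT) /orP[/andP[/eqP -> /eqP ->]|] //.
by move=> /negP h h'; case: h; apply/Z.eqb_eq.
Qed.

Section Rates.
Variable F : realFieldType.
Local Notation qR := (@qR F).

Lemma ZR_eq0 (z : Z) : (@ZR F z == 0) = Z.eqb z Z0.
Proof.
rewrite /ZR intr_eq0; apply/eqP/idP => [h|/Z.eqb_eq -> //].
apply/Z.eqb_eq; rewrite -[z]int_of_ZK h //.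
Qed.

Definition monic_cubic (b c d : F) : {poly F} := 'X^3 + b *: 'X^2 + c *: 'X + d%:P.

Lemma horner_monic_cubic b c d x :
  (monic_cubic b c d).[x] = x ^+ 3 + b * x ^+ 2 + c * x + d.
Proof. by rewrite /monic_cubic !(hornerD, hornerZ, hornerXn, hornerX, hornerC). Qed.

Lemma size_monic_cubic b c d : size (monic_cubic b c d) = 4%N.
Proof.
rewrite /monic_cubic -!addrA size_polyDl size_polyXn //.
apply: leq_ltn_trans (size_polyD _ _) _; rewrite gtn_max ltnS.
rewrite (leq_trans (size_scale_leq _ _)) ?size_polyXn //=.
apply: leq_ltn_trans (size_polyD _ _) _; rewrite gtn_max ltnS.
rewrite (leq_trans (size_scale_leq _ _)) ?size_polyX //=.
by apply: leq_ltn_trans (size_polyC_leq1 _) _.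
Qed.

Definition cubic := monic_cubic (qR cub2) (qR cub1) (qR cub0).

Lemma horner_cubic x :
  cubic.[x] = x ^+ 3 + qR cub2 * x ^+ 2 + qR cub1 * x + qR cub0.
Proof. exact: horner_monic_cubic. Qed.

Lemma qR_cubQ q : qR (cubQ q) = cubic.[qR q].
Proof.
rewrite horner_cubic /cubQ; move: cub2 cub1 cub0 => b c d.
by rewrite !qR_add !qR_mul; ring.
Qed.

End Rates.

Lemma rat_root_cubic_form (c2 c1 c0 : Q) (x : rat) :
  let D q := Zpos (Qden q) in
  x ^+ 3 + qR rat c2 * x ^+ 2 + qR rat c1 * x + qR rat c0 = 0 ->
  cubic_form (Z.mul (D c2) (Z.mul (D c1) (D c0))) (Z.mul (Qnum c2) (Z.mul (D c1) (D c0)))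
    (Z.mul (Qnum c1) (Z.mul (D c2) (D c0))) (Z.mul (Qnum c0) (Z.mul (D c2) (D c1)))
    (Z_of_int (numq x)) (Z_of_int (denq x)) = Z0.
Proof.
case: c2 c1 c0 => [n2 d2] [n1 d1] [n0 d0]; rewrite /qR.
cbv beta iota zeta delta [Qnum Qden] => h.
set a := Z_of_int (numq x); set b := Z_of_int (denq x).
have aE : ZR rat a = (numq x)%:~R by rewrite /ZR Z_of_intK.
have bE : ZR rat b = (denq x)%:~R by rewrite /ZR Z_of_intK.
have b0 : ZR rat b != 0 by rewrite bE intr_eq0 denq_eq0.
have xE : x = ZR rat a / ZR rat b by rewrite aE bE divq_num_den.
apply/Z.eqb_eq; rewrite -(ZR_eq0 rat) /cubic_form !(ZR_add, ZR_mul).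
have [[e2 e1] e0] := (ZR_pos_neq0 rat d2, ZR_pos_neq0 rat d1, ZR_pos_neq0 rat d0).
move: h; rewrite xE.
move: (ZR rat n2) (ZR rat n1) (ZR rat n0) (ZR rat (Zpos d2)) (ZR rat (Zpos d1))
  (ZR rat (Zpos d0)) (ZR rat a) (ZR rat b) b0 e2 e1 e0 => m2 m1 m0 k2 k1 k0 p q q0 e2 e1 e0 h.
rewrite -(mulr0 (k2 * (k1 * k0) * (q * (q * q)))) -h; apply/eqP; field.
by rewrite q0 e2 e1 e0.
Qed.

Lemma Z_mod_dvdn (z : int) : Z.modulo (Z_of_int z) 43 = Z0 -> (43 %| `|z|)%N.
Proof.
move=> h; have [//|k hk] := (proj1 (Z.mod_divide (Z_of_int z) 43 _)) h.
by apply/dvdnP; exists (Z.to_nat (Z.abs k)); lia.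
Qed.

(** Modulo 43 a root would have numerator and denominator both zero, against coprimality. *)
Lemma cubic_no_rat_root (x : rat) : ~~ root (cubic rat) x.
Proof.
apply/rootP; rewrite horner_cubic => /rat_root_cubic_form form0.
have [ha hb] := cubic_form_zero cub_mod43T form0.
have : (43 %| gcdn `|numq x| `|denq x|)%N by rewrite dvdn_gcd !Z_mod_dvdn.
by have /eqP -> := coprime_num_den x.
Qed.

Lemma cubic_irreducible_rat : irreducible_poly (cubic rat).
Proof.
by apply: cubic_irreducible; [rewrite size_monic_cubic | exact: cubic_no_rat_root].
Qed.

(** * A left eigenvector for the rate of the second factor *)

Section Cofactors.
Variables (F : realFieldType) (la l11 l12 l13 l21 l22 l23 l31 l32 l33 : F).

(** Bottom-row cofactors of [la - l]: at an eigenvalue [la] they span the left kernel. *)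
Definition cof1 := l21 * l32 + (la - l22) * l31.
Definition cof2 := (la - l11) * l32 + l12 * l31.
Definition cof3 := (la - l11) * (la - l22) - l12 * l21.

Lemma cofactor_eigen y1 y2 y3 :
  la ^+ 3 + - (l11 + (l22 + l33)) * la ^+ 2
  + ((l11 * l22 - l12 * l21) + ((l11 * l33 - l13 * l31) + (l22 * l33 - l23 * l32))) * la
  + - (l11 * (l22 * l33 - l23 * l32) + (- (l12 * (l21 * l33 - l23 * l31))
       + l13 * (l21 * l32 - l22 * l31))) = 0 ->
  cof1 * (l11 * y1 + l12 * y2 + l13 * y3) + cof2 * (l21 * y1 + l22 * y2 + l23 * y3)
  + cof3 * (l31 * y1 + l32 * y2 + l33 * y3) = la * (cof1 * y1 + cof2 * y2 + cof3 * y3).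
Proof.
by move=> chi; rewrite -[RHS]subr0 -(mul0r y3) -chi /cof1 /cof2 /cof3; ring.
Qed.

Lemma norm_prod_le (x y X Y : F) : `|x| <= X -> `|y| <= Y -> `|x * y| <= X * Y.
Proof. by move=> *; rewrite normrM ler_pM. Qed.

Lemma cofactor_bounds : 14 / 100 <= la <= 15 / 100 ->
  `|l11| <= 1 / 100 -> `|l12| <= 1 / 100 -> `|l21| <= 1 / 100 -> `|l22| <= 1 / 100 ->
  `|l31| <= 1 / 40 -> `|l32| <= 1 / 100 ->
  [/\ `|cof1| <= 1 / 100, `|cof2| <= 1 / 100 & 1 / 64 <= cof3 <= 1 / 32].
Proof.
move=> /andP[p q] b11 b12 b21 b22 b31 b32.
have sub x : `|x| <= 1 / 100 -> 13 / 100 <= la - x <= 16 / 100.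
  by rewrite ler_norml => /andP[? ?]; apply/andP; split; lra.
have nsub x : `|x| <= 1 / 100 -> `|la - x| <= 16 / 100.
  move=> /sub/andP[h1 h2]; rewrite ger0_norm //; apply: le_trans h1.
  by lra.
split.
- apply: le_trans (ler_normD _ _) _.
  apply: le_trans (lerD (norm_prod_le b21 b32) (norm_prod_le (nsub _ b22) b31)) _.
  by lra.
- apply: le_trans (ler_normD _ _) _.
  apply: le_trans (lerD (norm_prod_le (nsub _ b11) b32) (norm_prod_le b12 b31)) _.
  by lra.
have := norm_prod_le b12 b21; rewrite ler_norml /cof3 => /andP[r1 r2].
have [/andP[s1 s2] /andP[t1 t2]] := (sub _ b11, sub _ b22).
have c13 : 0 <= 13 / 100 :> F by lra.
have u1 := ler_pM c13 c13 s1 t1.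
have u2 := ler_pM (le_trans c13 s1) (le_trans c13 t1) s2 t2.
by apply/andP; split; lra.
Qed.

End Cofactors.

(** The third term dominates: [k3 * h] is at least [h / 64], while the other two amount to at most
    [h / 200]. So [H] is positive and comparable to [h], and trading [h] for [100 * H] turns the
    quadratic error into one in [H]. *)
Lemma cofactor_estimate (F : realFieldType)
    (k1 k2 k3 la K h y1 y2 y3 n1 n2 n3 m1 m2 m3 e : F) :
  `|k1| <= 1 / 100 -> `|k2| <= 1 / 100 -> 1 / 64 <= k3 <= 1 / 32 -> 0 < h -> 0 <= K ->
  `|y1| <= 1 / 4 * h -> `|y2| <= 1 / 4 * h -> y3 = - h ->
  `|n1 - m1| <= K * h ^+ 2 -> `|n2 - m2| <= K * h ^+ 2 -> `|n3 - m3| <= K * h ^+ 2 ->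
  k1 * m1 + k2 * m2 + k3 * m3 = la * (k1 * y1 + k2 * y2 + k3 * y3) ->
  1 / 20 * h <= e <= 1 * h ->
  let H := - (k1 * y1 + k2 * y2 + k3 * y3) in
  [/\ 0 < H, 1 * H <= e <= 100 * H,
      `|- (k1 * n1 + k2 * n2 + k3 * n3) - la * H| <= K * 100 ^+ 2 * H ^+ 2 & H <= h].
Proof.
move=> B1 B2 /andP[B31 B32] h0 K0 b1 b2 y3h e1 e2 e3 eigen /andP[d1 d2] H.
have [lo hi] : 1 / 100 * h <= H /\ H <= 1 / 20 * h.
  have := norm_prod_le B1 b1; have := norm_prod_le B2 b2.
  rewrite !ler_norml /H y3h => /andP[p1 p2] /andP[p3 p4].
  by clear -p1 p2 p3 p4 B31 B32 h0; split; nra.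
have hH : h <= 100 * H by clear -lo; lra.
have k3n : `|k3| <= 1 / 32.
  by rewrite ger0_norm //; clear -B31; lra.
have -> : - (k1 * n1 + k2 * n2 + k3 * n3) - la * H =
    - (k1 * (n1 - m1) + k2 * (n2 - m2) + k3 * (n3 - m3)).
  by rewrite /H mulrN -eigen; ring.
clearbody H.
split; [by clear -lo h0; lra | by apply/andP; clear -d1 d2 hi hH; split; lra | | by clear -hi h0; lra].
have hh : K * h ^+ 2 <= K * 100 ^+ 2 * H ^+ 2.
  by rewrite -mulrA -exprMn ler_wpM2l // ler_sqr // nnegrE ?ltW // (lt_le_trans h0).
apply: le_trans hh; rewrite normrN.
apply: le_trans (ler_normD _ _) _; apply: le_trans (lerD (ler_normD _ _) (lexx _)) _.
have := norm_prod_le B1 e1; have := norm_prod_le B2 e2; have := norm_prod_le k3n e3.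
have : 0 <= K * h ^+ 2 by rewrite mulr_ge0 ?sqr_ge0.
by clear; move: (K * _) `|_| `|_| `|_| => a b c d *; lra.
Qed.

(** * Geometric decay inside the cones *)

Section Orbits.
Variable R : rcfType.
Local Notation q2R := (@qR R).

Lemma ratr_qR q : ratr (qR rat q) = q2R q.
Proof. by rewrite /qR /ZR fmorph_div !rmorph_int. Qed.

Lemma map_monic_cubic c2 c1 c0 :
  map_poly ratr (monic_cubic (qR rat c2) (qR rat c1) (qR rat c0)) =
  monic_cubic (q2R c2) (q2R c1) (q2R c0).
Proof.
rewrite -!ratr_qR; move: (qR rat c2) (qR rat c1) (qR rat c0) => b c d.
by rewrite /monic_cubic !rmorphD /= !map_polyZ !map_polyXn map_polyX map_polyC.
Qed.

Lemma map_cubic : map_poly ratr (cubic rat) = cubic R.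
Proof. exact: map_monic_cubic. Qed.

#[local] Opaque cubQ cubic.

Lemma qR_qn n d : q2R (qn n d) = (Pos.to_nat n)%:R / (Pos.to_nat d)%:R.
Proof. by rewrite /qR /qn -!positive_nat_Z !ZR_nat. Qed.

Lemma cubic_signs : [/\ (cubic R).[14 / 100] < 0, 0 < (cubic R).[15 / 100],
  0 < (cubic R).[1 / 100] & (cubic R).[2 / 100] < 0].
Proof.
have /and4P[s1 s2 s3 s4] := cub_signsT.
have lt0 n d : Qlt_b (cubQ (qn n d)) Q0 ->
    (cubic R).[(Pos.to_nat n)%:R / (Pos.to_nat d)%:R] < 0.
  by move=> /(@qR_lt R); rewrite qR0 qR_cubQ qR_qn.
have gt0 n d : Qlt_b Q0 (cubQ (qn n d)) ->
    0 < (cubic R).[(Pos.to_nat n)%:R / (Pos.to_nat d)%:R].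
  by move=> /(@qR_lt R); rewrite qR0 qR_cubQ qR_qn.
by split; [exact: (lt0 _ _ s1)|exact: (gt0 _ _ s2)|exact: (gt0 _ _ s3)|exact: (lt0 _ _ s4)].
Qed.

(** If [la ^+ b = (1 / 5) ^+ a], the rational polynomial [q] shares the root [la] with the
    irreducible cubic, hence is divisible by it and vanishes at the conjugate [mu] too; but
    [0 <= mu < la] excludes equal [b]-th powers. *)
Lemma cubic_rate : exists2 la : R, 14 / 100 <= la <= 15 / 100 &
  root (cubic R) la /\ forall a b, (0 < b)%N -> la ^+ b != (1 / 5) ^+ a.
Proof.
have [s1 s2 s3 s4] := cubic_signs.
have le1 : 14 / 100 <= 15 / 100 :> R by lra.
have le2 : 1 / 100 <= 2 / 100 :> R by lra.
have [|la la_in la_root] := @poly_ivt _ (cubic R) _ _ le1.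
  by rewrite !ltW.
have [|mu mu_in mu_root] := @poly_ivt _ (- cubic R) _ _ le2.
  by rewrite !hornerN oppr_le0 oppr_ge0 !ltW.
exists la => //; split=> // a b b0; apply/negP => /eqP lab.
set q : {poly rat} := 'X^b - ((1 / 5) ^+ a)%:P.
have qla x : (map_poly ratr q).[x] = x ^+ b - (1 / 5) ^+ a :> R.
  rewrite /q rmorphB /= map_polyXn map_polyC /= hornerD hornerN hornerXn hornerC.
  by rewrite rmorphXn /= fmorph_div rmorph1 rmorph_nat.
have := irreducible_poly_coprime q cubic_irreducible_rat.
case: (boolP (cubic rat %| q)%R) => [dv _|_ cop].
  have : root (map_poly ratr q) mu.
    have : cubic R %| map_poly ratr q by rewrite -map_cubic dvdp_map.
    move=> /dvdpP[r ->]; rewrite rootM; apply/orP; right.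
    by move: mu_root; rewrite !rootE hornerN oppr_eq0.
  rewrite /root qla -lab subr_eq0 => /eqP e.
  have : mu ^+ b < la ^+ b.
    have [mu0 mu_la] : 0 <= mu /\ mu < la.
      by clear -mu_in la_in; move/andP: mu_in => [? ?]; move/andP: la_in => [? ?]; split; lra.
    by rewrite (ltrXn2r _ mu0 mu_la) -lt0n.
  by rewrite e ltxx.
have : coprimep (cubic R) (map_poly ratr q) by rewrite -map_cubic coprimep_map.
by move=> /coprimep_root /(_ la_root); rewrite qla lab subrr eqxx.
Qed.

Lemma run_var5 t (v : nat -> R) : (t <= 10)%N -> run t v 5%N = v 4%N.
Proof.
elim: t => [|t IH] t10; first by rewrite /run take0.
by rewrite run_recr // /step gtn_eqF ?IH // ?(leq_trans (col_lt t10)) // ltnW.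
Qed.

Lemma next4_eq0 (v : nat -> R) : v 4%N = 0 -> next v 4%N = 0.
Proof.
move=> v0; rewrite /next /out_at /outE.
have -> : (4 < 4)%N = false by [].
by rewrite [LHS]/= run_var5 // v0 mul0r.
Qed.

(** [H] measures the deviation of the bottleneck edge after each cycle. *)
Definition settles (rate : R) (v : nat -> R) (H : nat -> R) :=
  exists c C K B : R, 0 < c /\ forall n, let u := iter n (@next R) v in
  [/\ tracks_cycle u, 0 < H n, c * H n <= edge_at 0 0 u - q2R bneck <= C * H n,
      `|H n.+1 - rate * H n| <= K * H n ^+ 2 & H n <= B * (1 / 2) ^+ n].

Lemma L_boundsE : [/\ `|q2R (Lij 1 1)| <= 1 / 500, `|q2R (Lij 1 2)| <= 1 / 100,
  `|q2R (Lij 2 1)| <= 1 / 200, `|q2R (Lij 2 2)| <= 1 / 100 &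
  [/\ `|q2R (Lij 3 1)| <= 1 / 40, `|q2R (Lij 3 2)| <= 1 / 500,
   forall i, i \in [:: 1; 2; 3; 4]%N -> q2R (Lij i 0) = 0,
   forall i, i \in [:: 1; 2; 3]%N -> q2R (Lij 4 i) = 0 & q2R (Lij 4 4) = 1 / 5]].
Proof.
have := L_boundsT.
move=> /and5P[h1 h2 h3 h4 /and5P[h5 h6 /allP h7 /allP h8 h9]].
have le x n d : Qle_bool (Qabs x) (qn n d) -> `|q2R x| <= (Pos.to_nat n)%:R / (Pos.to_nat d)%:R.
  by move=> /(@qR_le R); rewrite qR_abs qR_qn.
split; [exact: (le _ _ _ h1)|exact: (le _ _ _ h2)|exact: (le _ _ _ h3)|exact: (le _ _ _ h4)|].
split; [exact: (le _ _ _ h5)|exact: (le _ _ _ h6)| | |].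
- by move=> i /h7 h; rewrite (qR_eq R (Qeq_bool_eq _ _ h)) qR0.
- by move=> i /h8 h; rewrite (qR_eq R (Qeq_bool_eq _ _ h)) qR0.
- by rewrite (qR_eq R (Qeq_bool_eq _ _ h9)) (qR_qn 1%positive 5%positive).
Qed.

(** The invariant [P] supplies the vanishing of coordinates outside [cn_ks]: it is trivial for the
    first factor and says [v 4 = 0] for the second. The ratio 1/2, from [cn_hi], is crude, but makes
    the quadratic errors summable. *)
Lemma cone_orbit (C : cone_data) (P : (nat -> R) -> Prop) : cone_ok C ->
  (forall v, P v -> P (next v)) ->
  (forall v, P v -> forall k, (k < 5)%N -> k \notin cn_ks C -> k != cn_p C -> next v k = 0) ->
  exists2 h0 : R, 0 < h0 & exists2 K : R, 0 < K & forall h v, 0 < h -> h <= h0 ->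
  cone (cn_a C) (cn_r C) h v -> h = q2R (cn_s C) * v (cn_p C) -> P v ->
  forall n, let u := iter n (@next R) v in let hn := q2R (cn_s C) * u (cn_p C) in
  [/\ tracks_cycle u, cone (cn_a C) (cn_r C) hn u /\ P u, 0 < hn <= h0 * (1 / 2) ^+ n,
      q2R (cn_c C) * hn <= edge_at 0 0 u - q2R bneck <= q2R (cn_C C) * hn &
      forall j, (j < 5)%N -> `|next u j - lin (nth [::] Lrows j) u| <= K * hn ^+ 2].
Proof.
move=> ok Pn Pz; have [h0 h00 [K K0 HK]] := cone_step R ok.
have lo0 : 0 < q2R (cn_lo C).
  by move: ok => /and5P[_ _ /andP[lo0 _] _ _]; rewrite -(qR0 R); apply: qR_lt.
have hi2 : q2R (cn_hi C) <= 1 / 2.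
  move: ok => /and5P[_ _ /andP[_ /(@qR_lt R) hi2] _ _]; apply: ltW.
  by move: hi2; rewrite {2}/qR /= -!positive_nat_Z !ZR_nat.
exists h0 => //; exists K => // h v h_gt0 hh0 cv hE Pv.
have step n : let u := iter n (@next R) v in let hn := q2R (cn_s C) * u (cn_p C) in
    [/\ cone (cn_a C) (cn_r C) hn u, P u & 0 < hn <= h0 * (1 / 2) ^+ n].
  elim: n => [|n IH] u hn; first by rewrite /hn /u /= -hE expr0 mulr1 h_gt0 hh0.
  cbv zeta in IH; move: IH; set w := iter n _ v; set k := q2R _ * w _ => -[cw Pw /andP[k0 kh]].
  have kh0 : k <= h0.
    apply: le_trans kh _; rewrite -[X in _ <= X]mulr1 ler_pM2l //.
    by apply: exprn_ile1; lra.
  have [_ cn /andP[lo hi] _ _] := HK k w k0 kh0 cw (Pz w Pw).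
  have hnE : hn = q2R (cn_s C) * next w (cn_p C) by [].
  split; [exact: cn | exact: Pn |].
  apply/andP; split; first by apply: lt_le_trans lo; rewrite mulr_gt0.
  apply: (le_trans hi); rewrite exprS [X in _ <= X]mulrCA.
  have hi0 : 0 <= q2R (cn_hi C).
    by rewrite -(pmulr_lge0 _ k0) ltW // (lt_le_trans (mulr_gt0 lo0 k0)) // (le_trans lo hi).
  by rewrite ler_pM // ltW.
move=> n u hn; have [cu Pu /andP[hn0 hnh]] := step n.
have hnh0 : hn <= h0.
  apply: le_trans hnh _; rewrite -[X in _ <= X]mulr1 ler_pM2l //.
  by apply: exprn_ile1; lra.
have [t _ _ e l] := HK hn u hn0 hnh0 cu (Pz u Pu).
by split=> //; rewrite hn0 hnh.
Qed.

(** The perturbation coordinate itself serves as [H], since row 4 of the Jacobian is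
    [(0, 0, 0, 0, 1/5)]. *)
Lemma settlesA : exists2 h0 : R, 0 < h0 & forall h v, 0 < h -> h <= h0 ->
  cone (cn_a coneA) (cn_r coneA) h v -> h = v 4%N -> exists H, settles (1 / 5) v H.
Proof.
have all5 k : (k < 5)%N -> k \notin cn_ks coneA -> k != cn_p coneA -> False.
  by case: k => [|[|[|[|[|k]]]]].
have [|v _ k k5 k1 k2|h0 h00 [K K0 HK]] := @cone_orbit coneA (fun _ => True) coneA_ok.
- by [].
- by case: (all5 k k5 k1 k2).
exists h0 => // h v h_gt0 hh0 cv hE; exists (fun n => iter n (@next R) v 4%N).
have s1 : q2R (cn_s coneA) = 1 := qR1 R.
have hE' : h = q2R (cn_s coneA) * v 4%N by rewrite s1 mul1r.
have c0 : 0 < q2R (cn_c coneA).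
  by rewrite (qR_qn 9%positive 10%positive); apply: divr_gt0; rewrite ltr0n.
exists (q2R (cn_c coneA)), (q2R (cn_C coneA)), K, h0; split=> // n.
have := HK h v h_gt0 hh0 cv hE' I n; cbv zeta.
have -> : q2R (cn_s coneA) * iter n (@next R) v (cn_p coneA) = iter n (@next R) v 4%N.
  by rewrite s1 mul1r.
move=> [tc _ /andP[hn0 hnh] dev lin_err]; split; [exact: tc|exact: hn0|exact: dev| |exact: hnh].
have [_ _ _ _ [_ _ Li0 L4i L44]] := L_boundsE.
have := lin_err 4%N isT; rewrite lin_Lrow.
by rewrite (Li0 4%N isT) ?(L4i 1%N isT) ?(L4i 2%N isT) ?(L4i 3%N isT) L44 !mul0r !add0r => e; exact: e.
Qed.

Lemma rateB_cofactors (la : R) : 14 / 100 <= la <= 15 / 100 -> root (cubic R) la ->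
  exists (l : nat -> nat -> R) (k1 k2 k3 : R), [/\ forall i j, l i j = q2R (Lij i j),
   `|k1| <= 1 / 100, `|k2| <= 1 / 100, 1 / 64 <= k3 <= 1 / 32 &
   forall y1 y2 y3, k1 * (l 1 1 * y1 + l 1 2 * y2 + l 1 3 * y3)
     + k2 * (l 2 1 * y1 + l 2 2 * y2 + l 2 3 * y3)
     + k3 * (l 3 1 * y1 + l 3 2 * y2 + l 3 3 * y3) = la * (k1 * y1 + k2 * y2 + k3 * y3)].
Proof.
have w5 : 1 / 500 <= 1 / 100 :> R by lra.
have w2 : 1 / 200 <= 1 / 100 :> R by lra.
move=> la_in la_root.
have [b11 b12 b21 b22 [b31 b32 _ _ _]] := L_boundsE.
have [B1 B2 B3] := cofactor_bounds la_in (le_trans b11 w5) b12 (le_trans b21 w2) b22 b31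
  (le_trans b32 w5).
exists (fun i j => q2R (Lij i j)); do 3 eexists; split; [by []|exact: B1|exact: B2|exact: B3|].
have subst (C2 C1 C0 A B D : R) : C2 = A -> C1 = B -> C0 = D ->
    la ^+ 3 + C2 * la ^+ 2 + C1 * la + C0 = 0 -> la ^+ 3 + A * la ^+ 2 + B * la + D = 0.
  by move=> -> -> ->.
have [e2 e1 e0] := cub_coefE R.
have /rootP := la_root; rewrite horner_cubic => /(subst _ _ _ _ _ _ e2 e1 e0) chi.
by move=> y1 y2 y3; apply: cofactor_eigen chi.
Qed.

(** The cone size is only known to shrink by a factor in an interval. The left-eigenvector
    functional [eta] is multiplied by exactly [la] up to a quadratic error, and is positive on the
    cone. *)
Lemma settlesB (la : R) : 14 / 100 <= la <= 15 / 100 -> root (cubic R) la -> exists2 h0 : R, 0 < h0 & forall h v, 0 < h -> h <= h0 ->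
  cone (cn_a coneB) (cn_r coneB) h v -> h = - v 3%N -> v 4%N = 0 -> exists H, settles la v H.
Proof.
move=> la_in la_root.
have [l [k1 [k2 [k3 [lE0 B1 B2 B3 eigen]]]]] := rateB_cofactors la_in la_root.
clear la_in la_root.
have four k : (k < 5)%N -> k \notin cn_ks coneB -> k != cn_p coneB -> k = 4%N.
  by case: k => [|[|[|[|[|k]]]]].
have [|v v0 k k5 e1 e2|h0 h00 [K K0 HK]] := @cone_orbit coneB (fun v => v 4%N = 0) coneB_ok.
- exact: next4_eq0.
- by rewrite (four k k5 e1 e2) next4_eq0.
pose eta (v : nat -> R) := - (k1 * v 1%N + k2 * v 2%N + k3 * v 3%N).
exists h0 => // h v h_gt0 hh0 cv hE v40; exists (fun n => eta (iter n (@next R) v)).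
have s1 : q2R (cn_s coneB) = -1.
  by rewrite -[cn_s coneB]/(Qopp Q1) qR_opp qR1.
have hE' : h = q2R (cn_s coneB) * v 3%N by rewrite s1 mulN1r.
have cE : q2R (cn_c coneB) = 1 / 20 := qR_qn 1%positive 20%positive.
have CE : q2R (cn_C coneB) = 1 := qR1 R.
exists 1, 100, (K * 100 ^+ 2), h0; split=> // n.
have := HK h v h_gt0 hh0 cv hE' v40 n; cbv zeta.
have -> : q2R (cn_s coneB) * iter n (@next R) v (cn_p coneB) = - iter n (@next R) v 3%N.
  by rewrite s1 mulN1r.
rewrite cE CE.
move: (iter n (@next R) v) (iterS n (@next R) v) => u -> [tc [cu u4] /andP[hn0 hnh] dev lin_err].
have [u1 u2] : `|u 1%N| <= 1 / 4 * - u 3%N /\ `|u 2%N| <= 1 / 4 * - u 3%N.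
  have := cu 1%N isT; have := cu 2%N isT.
  rewrite -[gr (cn_a coneB) 1]/(qn 5 24) -[gr (cn_a coneB) 2]/(qn 1 6).
  rewrite -[gr (cn_r coneB) 1]/(qn 1 40) -[gr (cn_r coneB) 2]/(qn 1 40) !qR_qn.
  rewrite -[Pos.to_nat 5]/5%N -[Pos.to_nat 24]/24%N -[Pos.to_nat 1]/1%N -[Pos.to_nat 6]/6%N
          -[Pos.to_nat 40]/40%N.
  move: hn0; move: (- u 3%N) (u 1%N) (u 2%N); clear => hn x y hn0.
  by rewrite !ler_norml => /andP[? ?] /andP[? ?]; split; apply/andP; split; lra.
have [_ _ _ _ [_ _ Li0 _ _]] := L_boundsE.
have lE j : j \in [:: 1; 2; 3]%N ->
    `|next u j - (l j 1 * u 1%N + l j 2 * u 2%N + l j 3 * u 3%N)| <= K * (- u 3%N) ^+ 2.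
  move=> j123; have j5 : (j < 5)%N by move: j123; rewrite !inE => /or3P[] /eqP ->.
  have := lin_err j j5; rewrite lin_Lrow u4 mulr0 addr0.
  rewrite (Li0 j) ?mul0r ?add0r -?lE0 //.
  by rewrite !inE; move: j123; rewrite !inE => /or3P[] /eqP ->.
have [E1 E2 E3 E4] := cofactor_estimate B1 B2 B3 hn0 (ltW K0) u1 u2 (esym (opprK _))
  (lE 1%N isT) (lE 2%N isT) (lE 3%N isT) (eigen _ _ _) dev.
by split; [exact: tc | exact: E1 | exact: E2 | exact: E3 | exact: le_trans E4 hnh].
Qed.

End Orbits.

(** * Two interleaved geometric sequences *)

Section Interleaving.
Variable R : realType.

Lemma exprn_small (r e : R) : 0 < r -> r < 1 -> 0 < e -> exists k, r ^+ k < e.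
Proof.
move=> r0 r1 e0; have h : `|r| < 1 by rewrite gtr0_norm.
have /cvgrPdist_lt /(_ e e0) [n _ hn] := cvg_expr h.
exists n; have := hn n (leqnn n); rewrite /= sub0r normrN.
by apply: le_lt_trans; apply: ler_norm.
Qed.

(** Otherwise [(y / x) ^+ k] would drop below [c / (|C| + 1)]. *)
Lemma exprn_compare (x y c C : R) : 0 < x -> 0 < y -> 0 < c ->
  (forall k, c * x ^+ k <= C * y ^+ k) -> x <= y.
Proof.
move=> x0 y0 c0 h; rewrite leNgt; apply/negP => yx.
have z0 : 0 < y / x by rewrite divr_gt0.
have z1 : y / x < 1 by rewrite ltr_pdivrMr // mul1r.
have C0 : 0 < `|C| + 1 by rewrite ltr_wpDl.
have [k hk] := exprn_small z0 z1 (divr_gt0 c0 C0).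
have xk : 0 < x ^+ k by rewrite exprn_gt0.
have yk : 0 < y ^+ k by rewrite exprn_gt0.
have h1 := h k.
have h2 : C * y ^+ k <= (`|C| + 1) * y ^+ k.
  by rewrite ler_pM2r // (le_trans (ler_norm C)) // lerDl.
move: hk; rewrite expr_div_n ltr_pdivrMr // mulrAC ltr_pdivlMr // mulrC => h3.
by have := lt_le_trans h3 (le_trans h1 h2); rewrite ltxx.
Qed.

Variables (dA dB : nat -> R) (p q mA MA mB MB : R).
Hypothesis (p0 : 0 < p) (p1 : p < 1) (q0 : 0 < q) (q1 : q < 1).
Hypothesis (mA0 : 0 < mA) (mB0 : 0 < mB).
Hypothesis (hA : forall k, mA * p ^+ k <= dA k <= MA * p ^+ k).
Hypothesis (hB : forall k, mB * q ^+ k <= dB k <= MB * q ^+ k).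
Hypothesis indep : forall a b, (0 < b)%N -> q ^+ b != p ^+ a.

(** Completed cycles of each factor after [j] turns. Ties go to the first factor, whose columns have
    the smaller indices. *)
Fixpoint cnt j : nat * nat := if j is k.+1 then
  if dB (cnt k).2 <= dA (cnt k).1 then ((cnt k).1.+1, (cnt k).2) else ((cnt k).1, (cnt k).2.+1)
  else (0, 0)%N.
Definition win j := dB (cnt j).2 <= dA (cnt j).1.

Lemma cntA j : (cnt j.+1).1 = ((cnt j).1 + win j)%N.
Proof. by rewrite /= -/(win j); case: (win j); rewrite /= ?addn1 ?addn0. Qed.

Lemma cntB j : (cnt j.+1).2 = ((cnt j).2 + ~~ win j)%N.
Proof. by rewrite /= -/(win j); case: (win j); rewrite /= ?addn1 ?addn0. Qed.

Lemma dA_gt0 k : 0 < dA k.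
Proof. by have /andP[h _] := hA k; apply: lt_le_trans h; rewrite mulr_gt0 ?exprn_gt0. Qed.

Lemma dB_gt0 k : 0 < dB k.
Proof. by have /andP[h _] := hB k; apply: lt_le_trans h; rewrite mulr_gt0 ?exprn_gt0. Qed.

Lemma geometric_small (d : nat -> R) (r m M e : R) n : 0 < r -> r < 1 -> 0 < e ->
  (forall k, m * r ^+ k <= d k <= M * r ^+ k) -> exists k, d (n + k)%N < e.
Proof.
move=> r0 r1 e0 h; have M0 : 0 < `|M| + 1 by rewrite ltr_wpDl.
have [k hk] := exprn_small r0 r1 (divr_gt0 e0 M0).
exists k; have /andP[_ hd] := h (n + k)%N; apply: (le_lt_trans hd).
have rk : 0 < r ^+ k by rewrite exprn_gt0.
have rn : r ^+ n <= 1 by apply: exprn_ile1; apply: ltW.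
have rnk : r ^+ (n + k) <= r ^+ k by rewrite exprD ler_piMl // ltW.
have rnk0 : 0 <= r ^+ (n + k) by rewrite exprn_ge0 // ltW.
apply: (@le_lt_trans _ _ ((`|M| + 1) * r ^+ k)).
  apply: (@le_trans _ _ ((`|M| + 1) * r ^+ (n + k))); last by rewrite ler_pM2l.
  by rewrite ler_wpM2r // (le_trans (ler_norm M)) // lerDl.
by move: hk; rewrite ltr_pdivlMr // mulrC.
Qed.

Lemma some_win T : exists2 j, (T <= j)%N & win j.
Proof.
apply: contrapT => no.
have lose j : (T <= j)%N -> ~~ win j by move=> Tj; apply/negP => w; apply: no; exists j.
have c k : (cnt (T + k)).1 = (cnt T).1 /\ (cnt (T + k)).2 = ((cnt T).2 + k)%N.
  elim: k => [|k [IH1 IH2]]; first by rewrite !addn0.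
  have w := lose (T + k)%N (leq_addr _ _).
  by rewrite !addnS cntA cntB IH1 IH2 (negPf w) addn0 /= addn1.
have [k hk] := geometric_small (cnt T).2 q0 q1 (dA_gt0 (cnt T).1) hB.
have := lose (T + k)%N (leq_addr _ _); rewrite /win; have [-> ->] := c k.
by rewrite (ltW hk).
Qed.

Lemma some_loss T : exists2 j, (T <= j)%N & ~~ win j.
Proof.
apply: contrapT => no.
have lose j : (T <= j)%N -> win j.
  by move=> Tj; apply/negPn/negP => w; apply: no; exists j.
have c k : (cnt (T + k)).1 = ((cnt T).1 + k)%N /\ (cnt (T + k)).2 = (cnt T).2.
  elim: k => [|k [IH1 IH2]]; first by rewrite !addn0.
  have w := lose (T + k)%N (leq_addr _ _).
  by rewrite !addnS cntA cntB IH1 IH2 w addn0 /= addn1.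
have [k hk] := geometric_small (cnt T).1 p0 p1 (dB_gt0 (cnt T).2) hA.
have := lose (T + k)%N (leq_addr _ _); rewrite /win; have [-> ->] := c k.
by rewrite leNgt hk.
Qed.

(** Over one period the two deviations shrink by [p ^+ al] and [q ^+ be], and each
    factor wins once per period, so these must agree. *)
Lemma win_not_periodic l T : (0 < l)%N ->
  ~ (forall j, (T <= j)%N -> win (j + l) = win j).
Proof.
move=> l0 per.
pose al := ((cnt (T + l)).1 - (cnt T).1)%N; pose be := ((cnt (T + l)).2 - (cnt T).2)%N.
have monA j k : ((cnt j).1 <= (cnt (j + k)).1)%N.
  by elim: k => [|k IH]; rewrite ?addn0 // addnS cntA (leq_trans IH) // leq_addr.
have monB j k : ((cnt j).2 <= (cnt (j + k)).2)%N.
  by elim: k => [|k IH]; rewrite ?addn0 // addnS cntB (leq_trans IH) // leq_addr.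
have shift j : (T <= j)%N ->
    (cnt (j + l)).1 = ((cnt j).1 + al)%N /\ (cnt (j + l)).2 = ((cnt j).2 + be)%N.
  move=> /subnKC <-; elim: (j - T)%N => [|k [IH1 IH2]].
    by rewrite addn0 /al /be !subnKC.
  have w := per (T + k)%N (leq_addr _ _).
  by rewrite addnS addSn !cntA !cntB IH1 IH2 w; split; rewrite addnAC.
have shiftk j k : (T <= j)%N -> [/\ win (j + k * l) = win j,
    (cnt (j + k * l)).1 = ((cnt j).1 + k * al)%N & (cnt (j + k * l)).2 = ((cnt j).2 + k * be)%N].
  move=> Tj; elim: k => [|k [IH0 IH1 IH2]]; first by rewrite !mul0n !addn0.
  have Tk : (T <= j + k * l)%N by apply: leq_trans Tj (leq_addr _ _).
  have [s1 s2] := shift _ Tk.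
  have e : (j + k.+1 * l = j + k * l + l)%N by rewrite mulSn addnCA addnC.
  by rewrite e per // IH0 s1 s2 IH1 IH2 -!addnA -!mulSnr.
have [j1 T1 w1] := some_win T; have [j2 T2 w2] := some_loss T.
(* The loss at [j2] makes the second factor move at least once per period. *)
have be0 : (0 < be)%N.
  have [_ s] := shift _ T2.
  have := monB j2.+1 l.-1; rewrite addSn -addnS prednK // cntB w2 s addn1.
  by rewrite -addn1 leq_add2l.
have pw (r : R) n k e : r ^+ (n + k * e) = r ^+ n * (r ^+ e) ^+ k.
  by rewrite exprD mulnC exprM.
have x0 : 0 < p ^+ al by rewrite exprn_gt0.
have y0 : 0 < q ^+ be by rewrite exprn_gt0.
(* The win at [j1] recurs in every period, so powers of [q ^+ be] are dominated by those of
   [p ^+ al]; the loss at [j2] gives the converse. *)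
have le1 : q ^+ be <= p ^+ al.
  apply: (@exprn_compare _ _ (mB * q ^+ (cnt j1).2) (MA * p ^+ (cnt j1).1)) => //.
    by rewrite mulr_gt0 ?exprn_gt0.
  move=> k; have [e0 e1 e2] := shiftk j1 k T1.
  move: e0; rewrite w1 /win e1 e2 => w.
  have /andP[h1 _] := hB ((cnt j1).2 + k * be)%N.
  have /andP[_ h2] := hA ((cnt j1).1 + k * al)%N.
  by have := le_trans h1 (le_trans w h2); rewrite !pw !mulrA.
have le2 : p ^+ al <= q ^+ be.
  apply: (@exprn_compare _ _ (mA * p ^+ (cnt j2).1) (MB * q ^+ (cnt j2).2)) => //.
    by rewrite mulr_gt0 ?exprn_gt0.
  move=> k; have [e0 e1 e2] := shiftk j2 k T2.
  move: e0; rewrite (negPf w2) /win e1 e2 => /negbT; rewrite -ltNge => w.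
  have /andP[h1 _] := hA ((cnt j2).1 + k * al)%N.
  have /andP[_ h2] := hB ((cnt j2).2 + k * be)%N.
  by have := le_trans h1 (le_trans (ltW w) h2); rewrite !pw !mulrA.
by have := indep al be0; rewrite eq_le le1 le2.
Qed.

End Interleaving.

(** * Scaling and the exact orbit of one factor *)

#[local] Opaque Lrows dev_grad envs.

Lemma negs_uniq i : uniq (negs i).
Proof.
have [i11|i11] := ltnP i 11; last by rewrite /negs nth_default.
have /allP : all uniq row_neg by []; apply; exact: mem_nth.
Qed.

Lemma negs_lt i k : k \in negs i -> (k < 5)%N.
Proof.
have [i11|i11] := ltnP i 11; last by rewrite /negs nth_default.
have /allP h : all (all (fun k => k < 5)%N) row_neg by [].
by move: k; apply/allP/h/mem_nth.
Qed.

Section Factor.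
Variable R : realType.
Implicit Types (Y v : nat -> R) (s : R).

Definition W Y i := eval Y (weightE i).
Definition Pos Y c := \sum_(i < 11 | ~~ neg i c) W Y i.
Definition Neg Y c := \sum_(i < 11 | neg i c) W Y i.
Definition eg Y c := (Pos Y c - Neg Y c) / (Pos Y c + Neg Y c).
Definition cf i (y : R) := if (i < 10)%N then qR R (ZQ (bw i)) else qR R (ZQ total_weight) * y.

Lemma W_E Y i : W Y i = (\prod_(k <- negs i) Y k) * cf i (Y 5%N).
Proof.
rewrite /W /weightE; have -> : cf i (Y 5%N) = eval Y (coefE i).
  by rewrite /cf /coefE; case: ifP.
elim: (negs i) => [|k l IH]; first by rewrite big_nil mul1r.
by rewrite big_cons -mulrA -IH.
Qed.
#[local] Opaque coefE weightE.

Lemma eval_sumE Y p : eval Y (sumE p) = \sum_(i < 11 | p i) W Y i.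
Proof.
rewrite /sumE -(big_mkord p (W Y)) /index_iota subn0.
elim: (iota 0 11) => [|i l IH]; first by rewrite big_nil /= qR0.
by rewrite big_cons /=; case: (p i) => //=; rewrite IH.
Qed.

Lemma eval_edgeE Y c : eval Y (edgeE c) = eg Y c.
Proof.
rewrite /edgeE [LHS]/= /posE /negE !eval_sumE -/(Pos Y c) -/(Neg Y c).
by rewrite -[ZQ (Zneg 1)]/(Qopp Q1) qR_opp qR1 mulN1r.
Qed.

Lemma stepE_val Y c : step Y c c = Y c * (Pos Y c / Neg Y c).
Proof. by rewrite /step eqxx /stepE [LHS]/= /posE /negE !eval_sumE. Qed.

Lemma step_neq Y c i : i != c -> step Y c i = Y i.
Proof. by rewrite /step => /negPf ->. Qed.

Lemma W_step Y c i : (c < 5)%N ->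
  W (step Y c) i = W Y i * (if neg i c then Pos Y c / Neg Y c else 1).
Proof.
move=> c5; rewrite !W_E step_neq; last by rewrite gtn_eqF.
rewrite mulrAC; congr (_ * _); rewrite /neg.
have := negs_uniq i; elim: (negs i) => [|k l IH] /=; first by rewrite !big_nil mulr1.
move=> /andP[kl ul]; rewrite !big_cons IH // inE.
have [ck|ck] := eqVneq c k; last by rewrite /= step_neq 1?eq_sym // mulrA.
by rewrite /= -ck in kl *; rewrite stepE_val (negPf kl) mulr1 mulrAC.
Qed.

Lemma W_scale s Y i : (i < 11)%N -> W (fun k => s * Y k) i = s ^+ 2 * W Y i.
Proof.
move=> i11; rewrite !W_E.
have -> : \prod_(k <- negs i) (s * Y k) = s ^+ size (negs i) * \prod_(k <- negs i) Y k.
  elim: (negs i) => [|k l IH]; first by rewrite !big_nil mulr1.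
  by rewrite !big_cons IH exprS; ring.
move: i11; rewrite ltnS leq_eqVlt => /orP[/eqP ->|i10].
  have cf10 y : cf 10 y = qR R (ZQ total_weight) * y by [].
  have -> : size (negs 10) = 1%N by [].
  by rewrite !cf10; move: (qR _ _) (\prod_(k <- _) _) => q p; ring.
have -> : size (negs i) = 2%N.
  have /allP h : all (fun i => size (negs i) == 2)%N (iota 0 10) by [].
  by apply/eqP/h; rewrite mem_iota.
have cfi y y' : cf i y = cf i y' by rewrite /cf i10.
by rewrite (cfi _ (Y 5%N)) mulrA.
Qed.

Lemma ZQ_weights : all (fun i => Qlt_b Q0 (ZQ (bw i))) (iota 0 10) && Qlt_b Q0 (ZQ total_weight).
Proof. by vm_compute. Qed.

Lemma cf_gt0 i (y : R) : (i < 10)%N -> 0 < cf i y.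
Proof.
move=> i10; have /andP[/allP h _] := ZQ_weights.
by rewrite /cf i10 -(qR0 R); apply/qR_lt/h; rewrite mem_iota.
Qed.

Lemma cf_ge0 i (y : R) : 0 <= y -> 0 <= cf i y.
Proof.
move=> y0; have [/cf_gt0/ltW//|i10] := ltnP i 10.
have /andP[_ h] := ZQ_weights; rewrite /cf ltnNge i10.
by rewrite mulr_ge0 // -(qR0 R) ltW //; apply: qR_lt.
Qed.

Lemma qR_ZQ_nat z : Qlt_b Q0 (ZQ z) -> qR R (ZQ z) \is a Num.nat.
Proof.
move=> /(@qR_lt R); rewrite qR0; case: z => [|p|p].
- by rewrite -[ZQ Z0]/Q0 qR0 ltxx.
- by rewrite -[ZQ _]/(qn p 1) qR_qn divr1 natr_nat.
- rewrite -[ZQ _]/(Qopp (qn p 1)) qR_opp qR_qn divr1 oppr_gt0 => h.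
  by have := ler0n R (Pos.to_nat p); rewrite leNgt h.
Qed.

Lemma cf_nat i (y : R) : y \is a Num.nat -> cf i y \is a Num.nat.
Proof.
move=> yn; have /andP[/allP h1 h2] := ZQ_weights; rewrite /cf.
case: ifP => i10; last by rewrite rpredM ?qR_ZQ_nat.
by apply/qR_ZQ_nat/h1; rewrite mem_iota.
Qed.
#[local] Opaque cf.

Lemma Pos_scale s Y c : Pos (fun k => s * Y k) c = s ^+ 2 * Pos Y c.
Proof. by rewrite /Pos mulr_sumr; apply: eq_bigr => i _; rewrite W_scale. Qed.

Lemma Neg_scale s Y c : Neg (fun k => s * Y k) c = s ^+ 2 * Neg Y c.
Proof. by rewrite /Neg mulr_sumr; apply: eq_bigr => i _; rewrite W_scale. Qed.

Lemma eg_scale s Y c : s != 0 -> eg (fun k => s * Y k) c = eg Y c.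
Proof.
move=> s0; rewrite /eg Pos_scale Neg_scale -mulrBr -mulrDr invfM mulrACA divff ?mul1r //.
by rewrite expf_neq0.
Qed.

Lemma step_scale s Y c : s != 0 -> step (fun k => s * Y k) c = (fun k => s * step Y c k).
Proof.
move=> s0; apply/funext => k; have [->|kc] := eqVneq k c; last by rewrite !step_neq.
rewrite !stepE_val Pos_scale Neg_scale -mulf_div divff ?mul1r ?mulrA //.
by rewrite expf_neq0.
Qed.

Lemma foldl_step_scale s Y l : s != 0 ->
  foldl (@step R) (fun k => s * Y k) l = (fun k => s * foldl (@step R) Y l k).
Proof. by move=> s0; elim: l Y => [//|c l IH] Y /=; rewrite step_scale // IH. Qed.

Lemma run_gt5 t v i : (t <= 10)%N -> (5 < i)%N -> run t v i = 0.
Proof.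
move=> t10 i5; elim: t t10 => [|t IH] t10.
  by rewrite /run take0 /= /start; move: i i5 => [|[|[|[|[|[|i]]]]]].
rewrite run_recr // step_neq ?IH // 1?ltnW // gtn_eqF //.
by apply: ltn_trans i5; apply: col_lt.
Qed.

Definition burst Y := foldl (@step R) Y pat.

(** Ten steps act as the return map [next] up to a scale, and edges are scale-invariant. *)
Lemma burst_start s v : s != 0 -> run 10 v 4%N != 0 ->
  burst (fun k => s * start v k) = (fun k => (s * run 10 v 4%N) * start (next v) k).
Proof.
move=> s0 r0; rewrite /burst foldl_step_scale //.
have -> : foldl (@step R) (start v) pat = run 10 v by [].
apply/funext => k; rewrite -mulrA; congr (_ * _).
have m1 : qR R (ZQ (Zneg 1)) = -1 by rewrite -[ZQ (Zneg 1)]/(Qopp Q1) qR_opp qR1.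
have lt4 j : (j < 4)%N -> run 10 v j = run 10 v 4 * (1 + next v j).
  move=> j4; rewrite /next /out_at /outE j4 [eval _ _]/= m1 addrC addrNK.
  by rewrite mulrCA divff ?mulr1.
have n4 : next v 4 = run 10 v 5 / run 10 v 4 by [].
rewrite /start; have [k4|k4] := ltnP k 4; first exact: lt4.
have [->|k4'] := eqVneq k 4%N; first by rewrite mulr1.
have [->|k5] := eqVneq k 5%N; first by rewrite n4 mulrCA divff ?mulr1.
rewrite mulr0 run_gt5 //; move: k4 k4' k5; clear.
by case: k => [|[|[|[|[|[|k]]]]]].
Qed.
#[local] Opaque next.

(** The quadratic error is summable, so [H n / rate ^+ n] stays between positive bounds. *)
Lemma geometric_bounds (H : nat -> R) (rate K B : R) : 0 < rate ->
  (forall n, [/\ 0 < H n, `|H n.+1 - rate * H n| <= K * H n ^+ 2 & H n <= B * (1 / 2) ^+ n]) ->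
  exists2 m : R, 0 < m & exists2 M : R, 0 < M & forall n, m * rate ^+ n <= H n <= M * rate ^+ n.
Proof.
move=> r0 HH.
have H0 n : 0 < H n by case: (HH n).
pose K' := `|K| + 1; have K'0 : 0 < K' by rewrite /K' ltr_wpDl.
pose B' := `|B| + 1; have B'0 : 0 < B' by rewrite /B' ltr_wpDl.
have hs n : 0 <= (1 / 2 : R) ^+ n by apply: exprn_ge0; lra.
have e0 : 0 < rate / (4 * K' * B') by rewrite divr_gt0 // !mulr_gt0.
have [hf0 hf1] : 0 < 1 / 2 :> R /\ 1 / 2 < 1 :> R by clear; split; lra.
(* From [N0] on, the [n]-th step multiplies by [rate] up to a relative error of
   [(1 / 2) ^+ n / 4]. *)
have [N0 hN0] := exprn_small hf0 hf1 e0.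
have near n : K' * H (N0 + n)%N <= rate / 4 * (1 / 2) ^+ n.
  have [_ _ h] := HH (N0 + n)%N.
  have h' : H (N0 + n)%N <= B' * (1 / 2) ^+ N0 * (1 / 2) ^+ n.
    apply: le_trans h _; rewrite -mulrA -exprD ler_wpM2r // /B'.
    by rewrite (le_trans (ler_norm B)) // lerDl.
  apply: (@le_trans _ _ (K' * (B' * (1 / 2) ^+ N0 * (1 / 2) ^+ n))); first by rewrite ler_pM2l.
  rewrite !mulrA ler_wpM2r //; move: (ltW hN0); rewrite ler_pdivlMr ?mulr_gt0 //; nra.
have err n : `|H (N0 + n.+1)%N - rate * H (N0 + n)%N| <= rate / 4 * (1 / 2) ^+ n * H (N0 + n)%N.
  have [_ h _] := HH (N0 + n)%N; rewrite addnS; apply: le_trans h _.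
  rewrite expr2 mulrA ler_pM2r //; apply: le_trans (near n).
  by rewrite ler_pM2r // /K' (le_trans (ler_norm K)) // lerDl.
(* The terms in [d = (1 / 2) ^+ n] let the induction close: for [0 <= d <= 1],
   [(1 + d) * (1 - d / 4) >= 1 + d / 2] and [(2 - d) * (1 + d / 4) <= 2 - d / 2]. *)
have tail n : H N0 * ((1 + (1 / 2) ^+ n) / 2) * rate ^+ n <= H (N0 + n)%N /\
    H (N0 + n)%N <= H N0 * (2 - (1 / 2) ^+ n) * rate ^+ n.
  elim: n => [|n [lo hi]].
    by rewrite addn0 !expr0; have := H0 N0; split; lra.
  have := err n; have := hs n; have h1 : (1 / 2 : R) ^+ n <= 1 by apply: exprn_ile1; lra.
  rewrite exprS exprS; move: lo hi (H0 N0) (H0 (N0 + n)%N) (H0 (N0 + n.+1)%N) h1.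
  have := exprn_gt0 n r0.
  move: ((1 / 2) ^+ n) (rate ^+ n) (H N0) (H (N0 + n)%N) (H (N0 + n.+1)%N) => d p a x y.
  move=> p0 lo hi a0 x0 y0 d1 d0; rewrite ler_norml => /andP[e1 e2]; clear -p0 lo hi a0 x0 y0 d1 d0 e1 e2 r0.
  have f1 : rate * x * (1 - d / 4) <= y by lra.
  have f2 : y <= rate * x * (1 + d / 4) by lra.
  have ap : 0 < a * p * rate by rewrite !mulr_gt0.
  split.
  - apply: le_trans f1.
    have g : rate * (a * ((1 + d) / 2) * p) * (1 - d / 4) <= rate * x * (1 - d / 4).
      by rewrite ler_wpM2r ?ler_pM2l //; lra.
    apply: le_trans g; rewrite -subr_ge0.
    have -> : rate * (a * ((1 + d) / 2) * p) * (1 - d / 4) - a * ((1 + 1 / 2 * d) / 2) * (rate * p)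
      = a * p * rate * (d * (1 - d) / 8) by field.
    by rewrite mulr_ge0 ?(ltW ap) // divr_ge0 // mulr_ge0 // subr_ge0.
  - apply: le_trans f2 _.
    have g : rate * x * (1 + d / 4) <= rate * (a * (2 - d) * p) * (1 + d / 4).
      by rewrite ler_wpM2r ?ler_pM2l //; lra.
    apply: le_trans g _; rewrite -subr_ge0.
    have -> : a * (2 - 1 / 2 * d) * (rate * p) - rate * (a * (2 - d) * p) * (1 + d / 4)
      = a * p * rate * (d * d / 4) by field.
    by rewrite mulr_ge0 ?(ltW ap) // divr_ge0 // mulr_ge0.
(* The initial terms are absorbed into the constants one at a time. *)
have from n0 m M : 0 < m -> 0 < M ->
    (forall n, (n0 <= n)%N -> m * rate ^+ n <= H n <= M * rate ^+ n) ->
    exists2 m : R, 0 < m & exists2 M : R, 0 < M & forall n, m * rate ^+ n <= H n <= M * rate ^+ n.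
  elim: n0 m M => [|n0 IH] m M m0 M0 h; first by exists m => //; exists M => // n; apply: h.
  have p0 := exprn_gt0 n0 r0.
  apply: (IH (Num.min m (H n0 / rate ^+ n0)) (Num.max M (H n0 / rate ^+ n0))).
  - by rewrite lt_min m0 divr_gt0.
  - by rewrite lt_max M0.
  move=> n; have pn := exprn_gt0 n r0.
  rewrite leq_eqVlt => /orP[/eqP <-|/h /andP[h1 h2]].
    apply/andP; split; first by rewrite -ler_pdivlMr // ge_min lexx orbT.
    by rewrite -ler_pdivrMr // le_max lexx orbT.
  apply/andP; split; [apply: le_trans h1 | apply: (le_trans h2)]; rewrite ler_pM2r //.
    by rewrite ge_min lexx.
  by rewrite le_max lexx.
have q0 := exprn_gt0 N0 r0.
apply: (from N0 (H N0 / 2 / rate ^+ N0) (2 * H N0 / rate ^+ N0)).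
- by rewrite !divr_gt0.
- by rewrite divr_gt0 // mulr_gt0.
move=> n hn; have [lo hi] := tail (n - N0)%N; rewrite (subnKC hn) in lo hi.
have rn : rate ^+ n = rate ^+ N0 * rate ^+ (n - N0) by rewrite -exprD subnKC.
have qn0 := exprn_gt0 (n - N0) r0; have dn := hs (n - N0)%N.
have e z : z / rate ^+ N0 * rate ^+ n = z * rate ^+ (n - N0).
  by rewrite rn mulrA divfK ?lt0r_neq0.
rewrite !e.
apply/andP; split; [apply: le_trans lo | apply: le_trans hi _]; rewrite ler_pM2r //.
  by have := H0 N0; nra.
by have := H0 N0; nra.
Qed.

End Factor.

(** * The product matrix *)

#[local] Opaque weightE coefE stepE edgeE next W step.

Section Selection.
Variables (R : realType) (m N : nat) (M : 'M[R]_(m, N)).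

Lemma sel_unique D (j : 'I_N) : (forall k : 'I_N, k != j ->
    edge M D k < edge M D j \/ (j < k)%N /\ edge M D k <= edge M D j) ->
  sel M D = Some j.
Proof.
move=> h; rewrite /sel.
have le k : edge M D k <= edge M D j.
  by have [->//|/h[/ltW//|[]//]] := eqVneq k j.
case: pickP => [i /andP[/forallP i1 /forallP i2]|/(_ j)/negbT/negP[]]; last first.
  apply/andP; split; first exact/forallP.
  apply/forallP => k; apply/implyP => kj.
  by case: (h k); [rewrite neq_ltn kj | | case=> jk _; move: (ltn_trans kj jk); rewrite ltnn].
congr Some; apply/eqP; apply/negPn/negP => ij.
case: (h i ij) => [lt|[ji _]]; first by have := lt_le_trans lt (i1 j); rewrite ltxx.
by have := i2 j; rewrite ji => /lt_le_trans/(_ (le i)); rewrite ltxx.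
Qed.

Lemma edge_dist (D D' : 'rV[R]_m) (j : 'I_N) (e : R) : pm_matrix M ->
  (forall i, `|D 0 i - D' 0 i| <= e) -> `|edge M D j - edge M D' j| <= e *+ m.
Proof.
move=> pm h; rewrite /edge -sumrB; apply: le_trans (ler_norm_sum _ _ _) _.
have -> : e *+ m = \sum_(i < m) e by rewrite sumr_const card_ord.
apply: ler_sum => i _; rewrite -mulrBl normrM.
have -> : `|M i j| = 1 by case: (pm i j) => ->; rewrite ?normrN normr1.
by rewrite mulr1.
Qed.

End Selection.

Import numFieldNormedType.Exports.

(** Both indices lie in one residue class modulo [l], with a common limit. The multiplier [q] is
    free so that the shift can also be a multiple of ten. *)
Lemma cycle_almost_periodic (R : realType) m (D : nat -> 'rV[R]_m) l (e : R) :
  converges_to_cycle D l -> 0 < e ->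
  exists T, forall t q, (T <= t)%N ->
  forall i, `|D t 0 i - D (t + q * l)%N 0 i| <= e.
Proof.
move=> [l0 [Dt cv]] e0.
have near b : (b < l)%N -> exists K, forall k, (K <= k)%N -> forall i,
    `|Dt b 0 i - D (k * l + b)%N 0 i| < e / 2.
  move=> bl; have : nbhs (Dt b) (fun N : 'rV[R]_m => forall i, `|Dt b 0 i - N 0 i| < e / 2).
    by apply/nbhs_ballP; exists (e / 2) => [|N [_ MN] i]; [rewrite /= divr_gt0 | exact: MN].
  by move=> /(cv b bl)[K _ hK]; exists K => k Kk; apply: hK.
have gen n : (n <= l)%N -> exists K, forall b, (b < n)%N -> forall k, (K <= k)%N -> forall i,
    `|Dt b 0 i - D (k * l + b)%N 0 i| < e / 2.
  elim: n => [|n IH] nl; first by exists 0%N.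
  have [K hK] := IH (ltnW nl); have [K' hK'] := near n nl.
  exists (maxn K K') => b; rewrite ltnS leq_eqVlt => /orP[/eqP ->|bn] k; rewrite geq_max => /andP[k1 k2].
    exact: hK'.
  exact: hK.
have [K hK] := gen l (leqnn l).
exists (K * l)%N => t q Kt i.
have bl : (t %% l < l)%N by rewrite ltn_mod.
have Kq : (K <= t %/ l)%N by rewrite leq_divRL.
have h1 := hK _ bl _ Kq i; have h2 := hK _ bl _ (leq_trans Kq (leq_addr q _)) i.
have e2 : ((t %/ l + q) * l + t %% l = t + q * l)%N.
  by rewrite mulnDl addnAC -divn_eq.
rewrite e2 in h2; rewrite -divn_eq in h1.
have -> : D t 0 i - D (t + q * l)%N 0 i =
  (Dt (t %% l)%N 0 i - D (t + q * l)%N 0 i) - (Dt (t %% l)%N 0 i - D t 0 i) by ring.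
by apply: le_trans (ler_normB _ _) _; lra.
Qed.

(** * Repeated rows, product weights and the margin *)

Section Rows.
Variable R : realType.
Implicit Types (f g w : nat -> R) (n : nat -> nat).

Definition rowT n := {a : 'I_11 & 'I_(n a)}.
Definition sg (b : bool) : R := if b then -1 else 1.
Definition tot w := \sum_(i < 11) w i.
Definition pe w c := (\sum_(i < 11) w i * sg (neg i c)) / tot w.
(** The normalised weight of one of the [n i] copies of row [i]; [supported] ensures that no weight
    sits on a row without copies. *)
Definition wt n w i := w i / (n i)%:R / tot w.
Definition supported n w := tot w != 0 /\ forall i, (i < 11)%N -> n i = 0%N -> w i = 0.

Lemma sum_rowT n f : \sum_(x : rowT n) f (tag x) = \sum_(a < 11) f a *+ n a.
Proof.
transitivity (\sum_(a < 11) \sum_(y : 'I_(n a)) f a).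
  by rewrite (sig_big_dep (I := 'I_11) (J := fun a : 'I_11 => 'I_(n a)) (fun=> true)
    (fun _ _ => true) (fun a _ => f a)).
by apply: eq_bigr => a _; rewrite sumr_const card_ord.
Qed.

Lemma sum_wt n w f : supported n w ->
  \sum_(a < 11) (wt n w a * f a) *+ n a = (\sum_(a < 11) w a * f a) / tot w.
Proof.
move=> [t0 z]; rewrite mulr_suml; apply: eq_bigr => a _; rewrite /wt -mulr_natr.
have [na|na] := eqVneq (n a) 0%N; first by rewrite na z // !mul0r.
by move: (w a) (f a) (tot w) t0 => u v t t0; field; rewrite t0 pnatr_eq0.
Qed.

Variables nA nB : nat -> nat.
Definition rows := (rowT nA * rowT nB)%type.
Definition rA (x : 'I_#|{: rows}|) : nat := tag (enum_val x).1.
Definition rB (x : 'I_#|{: rows}|) : nat := tag (enum_val x).2.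
Definition Mx : 'M[R]_(#|{: rows}|, 10) := \matrix_(x, j)
  if (j < 5)%N then sg (neg (rA x) j) else sg (neg (rB x) (j - 5)%N).
Definition Dprod w1 w2 : 'rV[R]_#|{: rows}| := \row_x (wt nA w1 (rA x) * wt nB w2 (rB x)).

Lemma Mx_pm : pm_matrix Mx.
Proof.
by move=> x j; rewrite mxE /sg; case: ifP => _; case: ifP => _; [right|left|right|left].
Qed.

Lemma sum_rows f g : \sum_x f (rA x) * g (rB x) =
  (\sum_(a < 11) f a *+ nA a) * (\sum_(b < 11) g b *+ nB b).
Proof.
rewrite -!sum_rowT big_distrlr /= pair_bigA.
by rewrite [RHS](big_enum_val (A := {: rows}) (fun p => f (tag p.1) * g (tag p.2))).
Qed.

Lemma sum_wt1 n w : supported n w -> \sum_(a < 11) wt n w a *+ n a = 1.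
Proof.
move=> s; have := sum_wt (fun=> 1) s.
under eq_bigr do rewrite mulr1.
by move=> ->; under eq_bigr do rewrite mulr1; rewrite divff //; case: s.
Qed.

Lemma edge_Dprod w1 w2 (j : 'I_10) : supported nA w1 -> supported nB w2 ->
  edge Mx (Dprod w1 w2) j = if (j < 5)%N then pe w1 j else pe w2 (j - 5)%N.
Proof.
move=> s1 s2; rewrite /edge; case: (ltnP j 5) => j5.
  transitivity (\sum_x (wt nA w1 (rA x) * sg (neg (rA x) j)) * wt nB w2 (rB x)).
    by apply: eq_bigr => x _; rewrite !mxE j5 mulrAC.
  rewrite (sum_rows (fun a => wt nA w1 a * sg (neg a j)) (wt nB w2)).
  by rewrite sum_wt1 // mulr1 (sum_wt (fun a => sg (neg a j)) s1).
transitivity (\sum_x wt nA w1 (rA x) * (wt nB w2 (rB x) * sg (neg (rB x) (j - 5)%N))).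
  by apply: eq_bigr => x _; rewrite !mxE ltnNge j5 /= mulrA.
rewrite (sum_rows (wt nA w1) (fun b => wt nB w2 b * sg (neg b (j - 5)%N))).
by rewrite sum_wt1 // mul1r (sum_wt (fun b => sg (neg b (j - 5)%N)) s2).
Qed.

Lemma Dprod_sum w1 w2 : supported nA w1 -> supported nB w2 -> \sum_x Dprod w1 w2 0 x = 1.
Proof.
move=> s1 s2; under eq_bigr do rewrite mxE.
by rewrite (sum_rows (wt nA w1) (wt nB w2)) !sum_wt1 // mulr1.
Qed.

Lemma card_rows : (#|{: rows}|%:R : R) = (\sum_(a < 11) (nA a)%:R) * (\sum_(b < 11) (nB b)%:R).
Proof.
have := sum_rows (fun=> 1) (fun=> 1); rewrite -[LHS]/(\sum_(x < _) (1 * 1)).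
by under eq_bigr do rewrite mulr1; rewrite sumr_const card_ord.
Qed.

Lemma Dprod_uniform w1 w2 :
  (forall i, (i < 11)%N -> w1 i = (nA i)%:R) -> (forall i, (i < 11)%N -> w2 i = (nB i)%:R) ->
  uniform R #|{: rows}| = Dprod w1 w2.
Proof.
move=> h1 h2; apply/rowP => x; rewrite !mxE card_rows /wt.
have tE n w (h : forall i, (i < 11)%N -> w i = (n i)%:R) : tot w = \sum_(a < 11) (n a)%:R.
  by apply: eq_bigr => i _; apply: h.
have pos n (y : rowT n) : (n (tag y) != 0)%N.
  by case: y => a [k /=]; case: (n a).
rewrite h1 ?h2 ?ltn_ord // !divff ?pnatr_eq0 ?pos //.
by rewrite (tE nA) // (tE nB) // !mul1r invfM.
Qed.

Lemma Pos_step (Y : nat -> R) c : (c < 5)%N -> Pos (step Y c) c = Pos Y c.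
Proof. by move=> c5; apply: eq_bigr => k /negPf kc; rewrite W_step // kc mulr1. Qed.

Lemma Neg_step (Y : nat -> R) c : (c < 5)%N -> 0 < Neg Y c -> Neg (step Y c) c = Pos Y c.
Proof.
move=> c5 Q0; rewrite /Neg; under eq_bigr => k kc do rewrite W_step // kc.
by rewrite -mulr_suml -/(Neg Y c) mulrCA divff ?mulr1 // lt0r_neq0.
Qed.

Lemma eg_step (Y : nat -> R) c : (c < 5)%N -> 0 < Neg Y c -> eg (step Y c) c = 0.
Proof. by move=> c5 Q0; rewrite /eg Pos_step // Neg_step // subrr mul0r. Qed.

(** After the step both masses equal [Pos Y c], so the total passes from [Pos Y c + Neg Y c] to
    twice [Pos Y c]; the AdaBoost denominators [1 + r] and [1 - r] contain exactly this
    renormalisation. *)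
Lemma wt_step n (Y : nat -> R) c i : (c < 5)%N -> 0 < Pos Y c -> 0 < Neg Y c ->
  wt n (W Y) i / (1 + eg Y c * sg (neg i c)) = wt n (W (step Y c)) i.
Proof.
move=> c5 P0 Q0; rewrite /wt W_step //.
have tE (Z : nat -> R) : tot (W Z) = Pos Z c + Neg Z c.
  by rewrite /tot (bigID (fun i : 'I_11 => neg i c)) /= addrC.
rewrite !tE Pos_step // Neg_step // /eg /sg; move: P0 Q0.
move: (Pos Y c) (Neg Y c) (W Y i) ((n i)%:R^-1) => p q u k p0 q0.
have p1 : p != 0 by rewrite lt0r_neq0.
have q1 : q != 0 by rewrite lt0r_neq0.
have s1 : p + q != 0 by rewrite lt0r_neq0 // addr_gt0.
have s2 : p + p != 0 by rewrite lt0r_neq0 // addr_gt0.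
have s3 : p + q + (p - q) != 0 by rewrite (_ : _ + _ = p + p) //; ring.
have s4 : p + q - (p - q) != 0.
  by rewrite (_ : _ - _ = q + q); [rewrite lt0r_neq0 // addr_gt0 | ring].
case: ifP => _.
  have -> : 1 + (p - q) / (p + q) * -1 = (q + q) / (p + q) by field.
  have s5 : q + q != 0 by rewrite lt0r_neq0 // addr_gt0.
  by field; rewrite ?s1 ?s2 ?s5 ?p1 ?q1 ?pnatr_eq0.
have -> : 1 + (p - q) / (p + q) * 1 = (p + p) / (p + q) by field.
by field; rewrite ?s1 ?s2 ?p1 ?pnatr_eq0.
Qed.

Lemma pe_eg (Y : nat -> R) c : pe (W Y) c = eg Y c.
Proof.
rewrite /pe /eg /tot (bigID (fun i : 'I_11 => neg i c)) /=.
rewrite [X in _ / X](bigID (fun i : 'I_11 => neg i c)) /= [X in _ / X]addrC.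
congr (_ / _); rewrite addrC; congr (_ + _).
  by apply: eq_bigr => i /negPf ic; rewrite /sg ic mulr1.
by rewrite -sumrN; apply: eq_bigr => i ic; rewrite /sg ic mulrN1.
Qed.

Lemma ada_stepA (YA YB : nat -> R) (j : 'I_10) : (j < 5)%N ->
  supported nA (W YA) -> supported nB (W YB) -> 0 < Pos YA j -> 0 < Neg YA j ->
  sel Mx (Dprod (W YA) (W YB)) = Some j ->
  ada_step Mx (Dprod (W YA) (W YB)) = Dprod (W (step YA j)) (W YB).
Proof.
move=> j5 sA sB P0 Q0 sj; rewrite /ada_step sj; apply/rowP => x.
by rewrite 4!mxE edge_Dprod // j5 pe_eg mulrAC wt_step.
Qed.

Lemma ada_stepB (YA YB : nat -> R) (j : 'I_10) c : (5 <= j)%N -> c = (j - 5)%N ->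
  supported nA (W YA) -> supported nB (W YB) -> 0 < Pos YB c -> 0 < Neg YB c ->
  sel Mx (Dprod (W YA) (W YB)) = Some j ->
  ada_step Mx (Dprod (W YA) (W YB)) = Dprod (W YA) (W (step YB c)).
Proof.
move=> j5 -> sA sB P0 Q0 sj; rewrite /ada_step sj; apply/rowP => x.
have jc : (j - 5 < 5)%N by have := ltn_ord j; lia.
have jF : (j < 5)%N = false by rewrite ltnNge j5.
by rewrite 4!mxE edge_Dprod // jF pe_eg -(wt_step nB (rB x) jc P0 Q0) mulrA.
Qed.

Lemma neg_sum i : (i < 11)%N -> 1 <= \sum_(c < 5) sg (neg i c).
Proof.
move=> i11.
have h : forall i, (i < 11)%N -> (\sum_(c < 5) (neg i c : nat) <= 2)%N.
  move=> k k11; have : all (fun k => neg k 0 + neg k 1 + neg k 2 + neg k 3 + neg k 4 <= 2)%N (iota 0 11) by [].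
  move=> /allP /(_ k); rewrite mem_iota k11 => /(_ isT).
  by rewrite !big_ord_recr big_ord0.
have -> : \sum_(c < 5) sg (neg i c) = 5 - 2 * (\sum_(c < 5) (neg i c : nat))%:R.
  rewrite natr_sum mulr_sumr.
  have -> : 5 = \sum_(c < 5) 1 :> R by rewrite sumr_const card_ord.
  by rewrite -sumrB; apply: eq_bigr => c _; case: (neg i c); rewrite /sg /=; ring.
have : ((\sum_(c < 5) (neg i c : nat))%:R : R) <= 2%:R by rewrite ler_nat h.
by lra.
Qed.

Lemma max_edge_ge m N (M : 'M[R]_(m, N)) D j : edge M D j <= max_edge M D.
Proof.
rewrite /max_edge; apply: ub_le_sup; last by exists j.
exists (\sum_k `|edge M D k|) => _ [k _ <-].
by rewrite (bigD1 k) //=; apply: le_trans (ler_norm _) _; rewrite lerDl sumr_ge0.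
Qed.

(** At most two of the first five entries of a row are negative, so the first five edges sum to at
    least 1. Equality is reached by [u], uniform on the ten row types with two negative columns:
    each column is negative on four of them. *)
Lemma margin_Mx : (forall i, (i < 10)%N -> (0 < nA i)%N) -> (forall i, (i < 10)%N -> (0 < nB i)%N) ->
  margin Mx = 1 / 5.
Proof.
move=> pA pB; pose u (i : nat) : R := if (i < 10)%N then 1 else 0.
have tu : tot u = 10 by rewrite /tot !big_ord_recr big_ord0 /u /=; ring.
have su n : (forall i, (i < 10)%N -> (0 < n i)%N) -> supported n u.
  move=> p; split; first by rewrite tu pnatr_eq0.
  by move=> i _ n0; rewrite /u; case: ifP => // /p; rewrite n0.
have wt0 n i : 0 <= wt n u i.
  by rewrite /wt tu !divr_ge0 // /u; case: ifP.
have peu c : (c < 5)%N -> pe u c = 1 / 5.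
  rewrite /pe tu !big_ord_recr big_ord0 /u /=.
  by case: c => [|[|[|[|[|c]]]]] // _; rewrite /sg /neg /=; field.
have Du : simplex (Dprod u u).
  by split; [move=> i; rewrite mxE mulr_ge0 | apply: Dprod_sum; apply: su].
have eu j : edge Mx (Dprod u u) j = 1 / 5.
  rewrite edge_Dprod; [|exact: su|exact: su].
  case: ifP => j5; apply: peu => //.
  by rewrite ltn_subLR ?(ltn_ord j) // leqNgt j5.
have lb : lbound [set max_edge Mx D | D in @simplex R #|{: rows}|]%classic (1 / 5).
  move=> _ [D [D0 D1] <-].
  have : 1 <= \sum_(c < 5) edge Mx D (widen_ord (isT : (5 <= 10)%N) c).
    rewrite /edge exchange_big /= -D1; apply: ler_sum => x _.
    rewrite -mulr_sumr -[X in X <= _]mulr1 ler_wpM2l //.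
    have := neg_sum (ltn_ord (tag (enum_val x).1)).
    by move=> h; apply: (le_trans h); apply: ler_sum => c _; rewrite mxE /= ltn_ord.
  have : \sum_(c < 5) edge Mx D (widen_ord (isT : (5 <= 10)%N) c) <= \sum_(c < 5) max_edge Mx D.
    by apply: ler_sum => c _; apply: max_edge_ge.
  rewrite sumr_const card_ord -mulr_natl; lra.
have mu : max_edge Mx (Dprod u u) = 1 / 5.
  apply/eqP; rewrite eq_le -{2}(eu ord0) max_edge_ge andbT.
  by apply: ge_sup; [exists (edge Mx (Dprod u u) ord0), ord0 | move=> _ [j _ <-]; rewrite eu].
apply/eqP; rewrite eq_le; apply/andP; split.
  by rewrite -{1}mu; apply: ge_inf; [exists (1 / 5) | exists (Dprod u u)].
by apply: lb_le_inf => //; exists (1 / 5), (Dprod u u).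
Qed.

End Rows.

(** * The AdaBoost orbit on the product matrix *)

#[local] Opaque cf weightE coefE stepE edgeE next W step.

Section Weights.
Variable R : realType.
Implicit Types (Y v : nat -> R).

Definition positive_state Y := (forall i, (i < 5)%N -> 0 < Y i) /\ 0 <= Y 5%N.

Lemma W_gt0 Y i : (i < 10)%N -> positive_state Y -> 0 < W Y i.
Proof.
move=> i10 [Y0 _]; rewrite W_E mulr_gt0 ?cf_gt0 //.
by rewrite big_seq; apply: prodr_gt0 => k /negs_lt; apply: Y0.
Qed.

Lemma W_ge0 Y i : positive_state Y -> 0 <= W Y i.
Proof.
move=> [Y0 Y5]; rewrite W_E mulr_ge0 ?cf_ge0 //.
by rewrite big_seq; apply: prodr_ge0 => k /negs_lt k5; rewrite ltW // Y0.
Qed.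

Lemma Pos_gt0 Y c : (c < 5)%N -> positive_state Y -> 0 < Pos Y c.
Proof.
move=> c5 pY.
have [i /andP[i10 ic]] : exists i : 'I_11, (i < 10)%N && ~~ neg i c.
  case: c c5 => [|[|[|[|[|c]]]]] // _.
  - by exists (Ordinal (isT : 4 < 11)%N).
  - by exists (Ordinal (isT : 1 < 11)%N).
  - by exists (Ordinal (isT : 0 < 11)%N).
  - by exists (Ordinal (isT : 0 < 11)%N).
  - by exists (Ordinal (isT : 0 < 11)%N).
rewrite /Pos (bigD1 i) //=; apply: ltr_pwDl; first exact: W_gt0.
by apply: sumr_ge0 => k _; apply: W_ge0.
Qed.

Lemma Neg_gt0 Y c : (c < 5)%N -> positive_state Y -> 0 < Neg Y c.
Proof.
move=> c5 pY.
have [i /andP[i10 ic]] : exists i : 'I_11, (i < 10)%N && neg i c.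
  case: c c5 => [|[|[|[|[|c]]]]] // _.
  - by exists (Ordinal (isT : 0 < 11)%N).
  - by exists (Ordinal (isT : 0 < 11)%N).
  - by exists (Ordinal (isT : 1 < 11)%N).
  - by exists (Ordinal (isT : 2 < 11)%N).
  - by exists (Ordinal (isT : 3 < 11)%N).
rewrite /Neg (bigD1 i) //=; apply: ltr_pwDl; first exact: W_gt0.
by apply: sumr_ge0 => k _; apply: W_ge0.
Qed.
#[local] Opaque Pos Neg eg.

Lemma tot_gt0 Y : positive_state Y -> 0 < tot (W Y).
Proof.
move=> pY; rewrite /tot (bigD1 ord0) //=; apply: ltr_pwDl; first exact: W_gt0.
by apply: sumr_ge0 => k _; apply: W_ge0.
Qed.

Lemma foldl_step_var5 Y l : all (fun c => c < 5)%N l -> foldl (@step R) Y l 5%N = Y 5%N.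
Proof.
elim: l Y => [//|c l IH] Y /= /andP[c5 l5]; rewrite IH // step_neq //.
by rewrite gtn_eqF.
Qed.

Lemma foldl_step_eq0 Y l i : all (fun c => c < 5)%N l -> W Y i = 0 ->
  W (foldl (@step R) Y l) i = 0.
Proof.
elim: l Y => [//|c l IH] Y /= /andP[c5 l5] w; apply: IH => //.
by rewrite W_step // w mul0r.
Qed.

Lemma pat_lt5 t : all (fun c => c < 5)%N (take t pat).
Proof. by apply/allP => c /mem_take; move: c; apply/allP. Qed.

Definition bn : R := qR R bneck.

(** [Y k t] is the state of one factor after [k] complete cycles and [t] further steps. *)
Record factor (n : nat -> nat) (Y : nat -> nat -> nat -> R) (rate : R) : Prop := Factor {
  fct_pos : forall k t, (t <= 10)%N -> positive_state (Y k t);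
  fct_supp : forall k t i, (i < 11)%N -> n i = 0%N -> W (Y k t) i = 0;
  fct_step : forall k t, (t < 10)%N -> Y k t.+1 = step (Y k t) (col t);
  fct_next : forall k, Y k.+1 0%N = Y k 10%N;
  fct_max : forall k t c, (t < 10)%N -> (c < 5)%N -> c != col t ->
    eg (Y k t) c < eg (Y k t) (col t);
  fct_gate : forall k t, (0 < t < 10)%N -> qR R gate < eg (Y k t) (col t);
  fct_wait : forall k, eg (Y k 0%N) 0 < qR R gate;
  fct_dev : exists m M : R, 0 < m /\
    forall k, m * rate ^+ k <= eg (Y k 0%N) 0 - bn <= M * rate ^+ k;
  fct_init : forall i, (i < 11)%N -> W (Y 0%N 0%N) i = (n i)%:R }.

(** [Y] follows the true orbit with its changing scale, whereas [settles] speaks of normalised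
    states; positivity and edges transfer because the scale stays positive. *)
Lemma factor_exists v (s rate : R) n H : 0 < s -> 0 <= v 4%N -> 0 < rate -> settles rate v H ->
  (forall i, (i < 11)%N -> W (fun k => s * start v k) i = (n i)%:R) ->
  exists Y : nat -> nat -> nat -> R, factor n Y rate.
Proof.
move=> s0 v4 r0 [c [C [K [B [c0 set]]]]] init.
pose Y0 : nat -> R := fun k => s * start v k.
have track k : tracks_cycle (iter k (@next R) v) by case: (set k).
have sc k : exists2 s', 0 < s' &
    iter k (@burst R) Y0 = fun i => s' * start (iter k (@next R) v) i.
  elim: k => [|k [s' s'0 IH]]; first by exists s.
  have [pos _ _ _] := track k; have p4 := pos 10%N 4%N isT isT.
  exists (s' * run 10 (iter k (@next R) v) 4%N); first by rewrite mulr_gt0.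
  by rewrite iterS IH burst_start ?lt0r_neq0 // iterS.
pose Y k t := foldl (@step R) (iter k (@burst R) Y0) (take t pat).
have YE k t : exists2 s', 0 < s' & Y k t = fun i => s' * run t (iter k (@next R) v) i.
  have [s' s'0 e] := sc k; exists s' => //.
  by rewrite /Y e foldl_step_scale ?lt0r_neq0.
have egE k t c' : eg (Y k t) c' = edge_at t c' (iter k (@next R) v).
  by have [s' s'0 ->] := YE k t; rewrite eg_scale ?lt0r_neq0 // /edge_at eval_edgeE.
have b5 k : iter k (@burst R) Y0 5%N = Y0 5%N.
  elim: k => [//|k IH]; rewrite iterS /burst foldl_step_var5 ?IH //.
exists Y; split.
- move=> k t t10; split; last first.
    by rewrite /Y foldl_step_var5 ?pat_lt5 // b5 /Y0 /start /= mulr_ge0 // ltW.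
  move=> i i5; have [s' s'0 ->] := YE k t; rewrite mulr_gt0 //.
  by have [pos _ _ _] := track k; apply: pos.
- move=> k t i i11 ni; apply: foldl_step_eq0; first exact: pat_lt5.
  elim: k => [|k IH]; first by rewrite /= init // ni.
  by rewrite iterS; apply: foldl_step_eq0.
- by move=> k t t10; rewrite /Y (take_nth 0%N) // -cats1 foldl_cat.
- by move=> k; rewrite /Y take0.
- move=> k t c' t10 c5 ne; rewrite !egE; have [_ h _ _] := track k; exact: h.
- by move=> k t t10; rewrite egE; have [_ _ h _] := track k; apply: h.
- by move=> k; rewrite egE; have [_ _ _ h] := track k; apply: h.
- have [|m m0 [M M0 h]] := @geometric_bounds R H rate K B r0.
    by move=> k; have [_ ? _ ? ?] := set k; split.
  have C0 : 0 < C.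
    have [_ H0 /andP[h1 h2] _ _] := set 0%N.
    by have := le_trans h1 h2; rewrite ler_pM2r // => /(lt_le_trans c0).
  exists (c * m), (C * M); split; first by rewrite mulr_gt0.
  move=> k; rewrite egE; have [_ H0 /andP[h1 h2] _ _] := set k.
  have /andP[g1 g2] := h k; rewrite -!mulrA; apply/andP; split.
    by apply: le_trans h1; rewrite ler_pM2l.
  by apply: le_trans h2 _; rewrite ler_pM2l.
- by move=> i i11; rewrite /Y take0 /=; apply: init.
Qed.

End Weights.

Section Orbit.
Variables (R : realType) (nA nB : nat -> nat) (YA YB : nat -> nat -> nat -> R) (p q : R).
Hypotheses (fA : factor nA YA p) (fB : factor nB YB q).

Let M := Mx R nA nB.
Let D a t b s := Dprod nA nB (W (YA a t)) (W (YB b s)).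
Let dA k := eg (YA k 0%N) 0 - bn R.
Let dB k := eg (YB k 0%N) 0 - bn R.
Let C := cnt dA dB.

Lemma supportedA a t : (t <= 10)%N -> supported nA (W (YA a t)).
Proof.
move=> t10; split; first by rewrite lt0r_neq0 // tot_gt0 //; apply: (fct_pos fA).
by move=> i; apply: (fct_supp fA).
Qed.

Lemma supportedB b s : (s <= 10)%N -> supported nB (W (YB b s)).
Proof.
move=> s10; split; first by rewrite lt0r_neq0 // tot_gt0 //; apply: (fct_pos fB).
by move=> i; apply: (fct_supp fB).
Qed.

Lemma edge_D a t b s (j : 'I_10) : (t <= 10)%N -> (s <= 10)%N ->
  edge M (D a t b s) j = if (j < 5)%N then eg (YA a t) j else eg (YB b s) (j - 5)%N.
Proof.
move=> t10 s10; rewrite /D edge_Dprod; [|exact: supportedA|exact: supportedB].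
by case: ifP => _; rewrite pe_eg.
Qed.

Lemma max0 n Y (r : R) k c : factor n Y r -> (c < 5)%N -> eg (Y k 0%N) c <= eg (Y k 0%N) 0.
Proof.
move=> f c5; have [->//|c0] := eqVneq c 0%N.
by apply/ltW/(fct_max f k (t := 0%N)).
Qed.

(** Inside a cycle [gate] separates the moving edge from the waiting one; only at [t = 0] do the
    excesses decide. A tie is allowed since the columns of this gadget come first. *)
Lemma stepA a t b : (t < 10)%N -> (t = 0%N -> eg (YB b 0%N) 0 <= eg (YA a 0%N) 0) ->
  ada_step M (D a t b 0) = D a t.+1 b 0.
Proof.
move=> t10 hwin; have c5 := col_lt t10; have c10 : (col t < 10)%N by apply: ltn_trans c5 _.
have pY := fct_pos fA a (ltnW t10).
pose j := Ordinal c10; rewrite /D (fct_step fA) //.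
apply: (@ada_stepA _ _ _ _ _ j); rewrite ?Pos_gt0 ?Neg_gt0 //.
- exact: supportedA (ltnW t10).
- exact: supportedB.
apply: sel_unique => k kj; rewrite -/M !edge_D // ?(ltnW t10) //= c5.
case: ifP => k5; first by left; apply: (fct_max fA).
right; split; first by rewrite (leq_trans c5) // leqNgt k5.
have k55 : (k - 5 < 5)%N by rewrite ltn_subLR ?(ltn_ord k) // leqNgt k5.
apply: le_trans (max0 _ fB k55) _.
have [t0|t0] := posnP t; first by rewrite t0; apply: hwin.
by apply/ltW/(lt_trans (fct_wait fB b))/(fct_gate fA); rewrite t0.
Qed.

Lemma stepB a b s : (s < 10)%N -> (s = 0%N -> eg (YA a 0%N) 0 < eg (YB b 0%N) 0) ->
  ada_step M (D a 0 b s) = D a 0 b s.+1.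
Proof.
move=> s10 hwin; have c5 := col_lt s10; have c10 : (5 + col s < 10)%N by rewrite (ltn_add2l 5 _ 5).
have pY := fct_pos fB b (ltnW s10).
pose j := Ordinal c10; have jc : col s = (j - 5)%N by rewrite /= addKn.
rewrite /D (fct_step fB) //.
apply: (@ada_stepB _ _ _ _ _ j (col s)); rewrite ?Pos_gt0 ?Neg_gt0 ?leq_addr //.
- exact: supportedA.
- exact: supportedB (ltnW s10).
apply: sel_unique => k kj; left; rewrite -/M !edge_D // ?(ltnW s10) //.
have -> : (j < 5)%N = false by [].
rewrite -jc; case: ifP => k5; last first.
  apply: (fct_max fB) => //; first by rewrite ltn_subLR ?(ltn_ord k) // leqNgt k5.
  apply: contra kj => /eqP e; apply/eqP/val_inj; rewrite /= -e subnKC //.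
  by rewrite leqNgt k5.
apply: le_lt_trans (max0 _ fA k5) _.
have [s0|s0] := posnP s; first by rewrite s0; apply: hwin.
by apply/(lt_trans (fct_wait fA a))/(fct_gate fB); rewrite s0.
Qed.

Lemma winE j : win dA dB j = (eg (YB (C j).2 0%N) 0 <= eg (YA (C j).1 0%N) 0).
Proof. by rewrite /win /dA /dB lerD2r. Qed.

Lemma within_burst j t : iter (10 * j) (ada_step M) (uniform R _) = D (C j).1 0 (C j).2 0 ->
  (t <= 10)%N -> iter (10 * j + t) (ada_step M) (uniform R _) =
  if win dA dB j then D (C j).1 t (C j).2 0 else D (C j).1 0 (C j).2 t.
Proof.
move=> e; elim: t => [|t IH] t10; first by rewrite addn0 e if_same.
rewrite addnS iterS IH ?(ltnW t10) // winE; case: ifP => w.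
  by apply: stepA.
by apply: stepB => // _; rewrite ltNge w.
Qed.

Lemma burst_start_orbit j : iter (10 * j) (ada_step M) (uniform R _) = D (C j).1 0 (C j).2 0.
Proof.
elim: j => [|j IH].
  by rewrite muln0 /=; apply: Dprod_uniform; [apply: (fct_init fA) | apply: (fct_init fB)].
rewrite mulnS addnC (within_burst IH) // /C /= -/C -/(win dA dB j).
by case: ifP => w; rewrite /D /= ?(fct_next fA) ?(fct_next fB).
Qed.

(** Column [0] tells who moved first in burst [j]: its edge vanishes exactly when
    the first factor has just used it. *)
Lemma edge_second j : edge M (ada_seq M (10 * j + 2)) ord0 =
  if win dA dB j then 0 else eg (YA (C j).1 0%N) 0.
Proof.
(* [ada_seq] starts at index 1, so index [10 * j + 2] is one step into turn [j]. *)
have -> : ada_seq M (10 * j + 2) = iter (10 * j + 1) (ada_step M) (uniform R _).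
  by rewrite /ada_seq addn2 addn1.
rewrite (within_burst (burst_start_orbit j)) //.
case: ifP => w; rewrite edge_D //.
rewrite (fct_step fA) // -[col 0]/0%N -[LHS]/(eg (step (YA (C j).1 0%N) 0) 0).
have pY := fct_pos fA (C j).1 (isT : 0 <= 10)%N.
by rewrite eg_step // Neg_gt0.
Qed.

Hypotheses (p0 : 0 < p) (p1 : p < 1) (q0 : 0 < q) (q1 : q < 1).
Hypothesis indep : forall a b, (0 < b)%N -> q ^+ b != p ^+ a.

Theorem no_finite_cycle : ~ converges_to_finite_cycle (ada_seq M).
Proof.
move=> [l cv]; have l0 : (0 < l)%N by case: cv.
have [mA [MA [mA0 hA]]] := fct_dev fA; have [mB [MB [mB0 hB]]] := fct_dev fB.
set m := #|{: rows nA nB}|.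
(* An edge changes by at most [m] times the entrywise distance, so this tolerance keeps the change
   within 1/5, which is below 7/23. *)
have e0 : 0 < 1 / (5 * m.+1%:R) :> R by rewrite divr_gt0 // mulr_gt0 // ltr0n.
have [T per] := cycle_almost_periodic cv e0.
apply: (win_not_periodic p0 p1 q0 q1 mA0 mB0 hA hB indep (l := l) (T := T)) => // j Tj.
have Tj' : (T <= 10 * j + 2)%N by lia.
(* A shift by ten periods compares turns [j] and [j + l] at the same phase. *)
have := edge_dist ord0 (@Mx_pm R nA nB) (per _ 10%N Tj').
have -> : (10 * j + 2 + 10 * l = 10 * (j + l) + 2)%N by lia.
rewrite -/M !edge_second -/m.
have small : 1 / (5 * m.+1%:R) *+ m <= 1 / 5 :> R.
  have m1 : 0 < m.+1%:R :> R by rewrite ltr0n.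
  rewrite -mulr_natr mulrAC ler_pdivrMr ?mulr_gt0 // mul1r.
  by rewrite mulKf ?pnatr_eq0 // mul1r ler_nat.
have bn_gt : 1 / 5 < bn R.
  rewrite /bn -[bneck]/(qn 7 23) qR_qn -[Pos.to_nat 7]/7%N -[Pos.to_nat 23]/23%N; lra.
have big k : 1 / 5 < eg (YA k 0%N) 0.
  have /andP[h _] := hA k; apply: lt_trans bn_gt _; rewrite -subr_gt0.
  by apply: lt_le_trans h; rewrite mulr_gt0 ?exprn_gt0.
move=> h; change (win dA dB (j + l) = win dA dB j); move: h.
case: (win dA dB j); case: (win dA dB (j + l)) => // h; exfalso.
  move: (le_trans h small); rewrite sub0r normrN => h'.
  by have := lt_le_trans (big _) (le_trans (ler_norm _) h'); rewrite ltxx.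
move: (le_trans h small); rewrite subr0 => h'.
by have := lt_le_trans (big _) (le_trans (ler_norm _) h'); rewrite ltxx.
Qed.

End Orbit.

(** * Integer initial states inside the cones *)

Section Start.
Variable R : realType.

Definition int_state (o : seq nat) : nat -> R := fun k => (nth 0%N o k)%:R.

Lemma int_state_start N (o : seq nat) (z : nat -> R) : (0 < N)%N -> size o = 6%N ->
  nth 0%N o 4 = N -> (forall k, (k < 4)%N -> (nth 0%N o k)%:R = N%:R + z k) ->
  (nth 0%N o 5)%:R = z 4%N ->
  int_state o = (fun k => N%:R * start (fun k => z k / N%:R) k).
Proof.
move=> N0 so o4 o03 o5; apply/funext => k.
have N1 : N%:R != 0 :> R by rewrite pnatr_eq0 -lt0n.
rewrite /int_state /start; case: ifP => k4; first by rewrite o03 // mulrDr mulr1 mulrCA divff ?mulr1.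
case: eqP => [->|k4']; first by rewrite o4 mulr1.
case: eqP => [->|k5]; first by rewrite o5 mulrCA divff ?mulr1.
by rewrite nth_default ?mulr0 // so; lia.
Qed.

(** Nothing is truncated: the weight is already a natural number, see [multE]. *)
Definition mult o i := Num.truncn (W (int_state o) i).

Lemma multE o i : W (int_state o) i = (mult o i)%:R.
Proof.
rewrite truncnK // W_E rpredM //; first by rewrite rpred_prod // => k _; apply: natr_nat.
by apply: cf_nat; apply: natr_nat.
Qed.

Lemma mult_gt0 o i : (forall k, (k < 5)%N -> (0 < nth 0 o k)%N) -> (i < 10)%N -> (0 < mult o i)%N.
Proof.
move=> h i10; rewrite -(ltr0n R) -multE W_gt0 //; split; last exact: ler0n.
by move=> k k5; rewrite ltr0n h.
Qed.

Lemma qR_int n : qR R (Qopp (qn n 1)) = - (Pos.to_nat n)%:R.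
Proof. by rewrite qR_opp qR_qn divr1. Qed.

Lemma cone_radii : all (fun C => all (fun k => Qle_bool Q0 (gr (cn_r C) k)) (iota 0 5))
  [:: coneA; coneB].
Proof. by vm_compute. Qed.

(** Exactly on the axis of [coneA] with [h = 1 / N]; [38 < N] keeps the entries positive. *)
Definition offA N := [:: N - 38; N + 1; N - 1; N - 32; N; 1]%N.
(** At [h = 24 / N] the axis of [coneB], times [N], is integral except for its first entry -15.6,
    rounded to -16 within the radius 0.6. The final 0 leaves row 10 without copies. *)
Definition offB N := [:: N - 16; N + 5; N + 4; N - 24; N; 0]%N.

Lemma factorA : exists2 h0 : R, 0 < h0 & forall N, (38 < N)%N -> 1 / N%:R <= h0 ->
  exists Y, @factor R (mult (offA N)) Y (1 / 5).
Proof.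
have [h0 h00 HA] := settlesA R; exists h0 => // N N38 Nh.
have N0 : 0 < N%:R :> R by rewrite ltr0n (leq_trans _ N38).
pose z k := qR R (gr (cn_a coneA) k).
have /andP[/allP rad _] := cone_radii.
have z4 : z 4%N = 1 by rewrite /z -[gr _ _]/Q1 qR1.
have sE : int_state (offA N) = (fun k => N%:R * start (fun k => z k / N%:R) k).
  apply: int_state_start; rewrite // ?z4 //; first exact: leq_trans N38.
  case=> [|[|[|[|k]]]] // _; rewrite /z.
  - by rewrite -[gr _ _]/(Qopp (qn 38 1)) qR_int /= natrB // ltnW.
  - by rewrite -[gr _ _]/Q1 qR1 /= natrD.
  - by rewrite -[gr _ _]/(Qopp (qn 1 1)) qR_int /= natrB // (leq_trans _ N38).
  - by rewrite -[gr _ _]/(Qopp (qn 32 1)) qR_int /= natrB // (leq_trans _ N38).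
have [|||H sH] := HA (1 / N%:R) (fun k => z k / N%:R) _ Nh.
- by rewrite divr_gt0.
- move=> k k5; rewrite -/(z k) mul1r mulrC subrr normr0 mulr_ge0 ?invr_ge0 ?ler0n //.
  by rewrite -(qR0 R); apply/qR_le/rad; rewrite mem_iota.
- by rewrite z4.
apply: (factor_exists N0 _ _ sH) => [||i i11]; last by rewrite -sE multE.
  by rewrite z4 divr_ge0 // ltW.
by rewrite divr_gt0.
Qed.

Lemma factorB (la : R) : 14 / 100 <= la <= 15 / 100 -> root (cubic R) la ->
  exists2 h0 : R, 0 < h0 & forall N, (38 < N)%N -> 24 / N%:R <= h0 ->
  exists Y, factor (mult (offB N)) Y la.
Proof.
move=> la_in la_root.
have la0 : 0 < la.
  by move: la_in; clear => /andP[h _]; apply: lt_le_trans h; rewrite divr_gt0.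
have [h0 h00 HB] := settlesB la_in la_root; exists h0 => // N N38 Nh.
clear la_in la_root.
have N0 : 0 < N%:R :> R by rewrite ltr0n (leq_trans _ N38).
have N1 : N%:R != 0 :> R by rewrite lt0r_neq0.
pose a k := qR R (gr (cn_a coneB) k).
have a0 : a 0%N = - (13 / 20) by rewrite /a -[gr _ _]/(Qopp (qn 13 20)) qR_opp qR_qn.
have a1 : a 1%N = 5 / 24 by rewrite /a -[gr _ _]/(qn 5 24) qR_qn.
have a2 : a 2%N = 1 / 6 by rewrite /a -[gr _ _]/(qn 1 6) qR_qn.
have a3 : a 3%N = -1 by rewrite /a -[gr _ _]/(Qopp Q1) qR_opp qR1.
have a4 : a 4%N = 0 by rewrite /a -[gr _ _]/Q0 qR0.
pose z k : R := if k == 0%N then -16 else 24 * a k.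
have /andP[_ /andP[/allP rad _]] := cone_radii.
have sE : int_state (offB N) = (fun k => N%:R * start (fun k => z k / N%:R) k).
  apply: int_state_start; rewrite // /z /= ?a4 ?mulr0 //; first exact: leq_trans N38.
  case=> [|[|[|[|k]]]] // _ /=.
  - by rewrite natrB // (leq_trans _ N38).
  - by rewrite natrD a1; congr (_ + _); field.
  - by rewrite natrD a2; congr (_ + _); field.
  - by rewrite natrB ?(leq_trans _ N38) // a3 mulrN1.
have [||||H sH] := HB (24 / N%:R) (fun k => z k / N%:R) _ Nh.
- by rewrite divr_gt0.
- move=> k k5; rewrite -/(a k) /z; case: eqP => [->|_].
    rewrite a0 -[gr _ 0]/(qn 1 40) qR_qn -[Pos.to_nat 1]/1%N -[Pos.to_nat 40]/40%N.
    have -> : -16 / N%:R - 24 / N%:R * - (13 / 20) = - (2 / 5) / N%:R :> R by field.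
    rewrite mulNr normrN gtr0_norm; last by rewrite !divr_gt0.
    by rewrite [X in _ <= X]mulrAC ler_pM2r ?invr_gt0 //; clear; lra.
  rewrite mulrAC subrr normr0; apply: mulr_ge0; first exact: (divr_ge0 (ler0n _ 24) (ltW N0)).
  by rewrite -(qR0 R); apply/qR_le/rad; rewrite mem_iota.
- by rewrite /z /= a3 mulrN1 mulNr opprK.
- by rewrite /z /= a4 mulr0 mul0r.
apply: (factor_exists N0 _ la0 sH) => [|i i11]; last by rewrite -sE multE.
by rewrite /z /= a4 mulr0 mul0r.
Qed.

Lemma sum_mult_gt0 (n : nat -> nat) : (0 < n 0)%N -> 0 < \sum_(a < 11) (n a)%:R :> R.
Proof.
move=> n0; rewrite (bigD1 ord0) //=; apply: ltr_pwDl; first by rewrite ltr0n.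
by apply: sumr_ge0.
Qed.

End Start.

Theorem theorem1 (R : realType) :
  exists (m N : nat) (M : 'M[R]_(m, N)),
    (0 < m)%N /\ (0 < N)%N /\ pm_matrix M /\
    margin M = 1 / 5 /\
    ~ converges_to_finite_cycle (ada_seq M).
Proof.
have [la la_in [la_root indep]] := cubic_rate R.
have [la0 la1] : 0 < la /\ la < 1.
  by move: la_in; clear => /andP[h1 h2]; split; lra.
have [hA hA0 HA] := factorA R; have [hB hB0 HB] := factorB la_in la_root.
have [N N38 [NA NB]] : exists2 N, (38 < N)%N & 1 / N%:R <= hA /\ 24 / N%:R <= hB.
  pose x : R := 1 / hA + 24 / hB.
  have xA : 0 < 1 / hA by rewrite divr_gt0.
  have xB : 0 < 24 / hB by rewrite divr_gt0.
  have x0 : 0 <= x by rewrite addr_ge0 // ltW.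
  exists (39 + Num.bound x)%N; first by rewrite leq_addr.
  have N0 : 0 < (39 + Num.bound x)%:R :> R by rewrite ltr0n.
  have xN : x <= (39 + Num.bound x)%:R.
    by rewrite (le_trans (ltW (archi_boundP x0))) // ler_nat leq_addl.
  rewrite !ler_pdivrMr // ![_ * (39 + _)%:R]mulrC -!ler_pdivrMr //.
  by split; apply: le_trans xN; rewrite /x ?lerDl ?lerDr ltW.
have [YA fA] := HA N N38 NA; have [YB fB] := HB N N38 NB.
have pos o i : o = offA N \/ o = offB N -> (i < 10)%N -> (0 < mult R o i)%N.
  move=> oE; apply: mult_gt0 => k k5.
  by case: oE => ->; case: k k5 => [|[|[|[|[|k]]]]] //= _; lia.
have pA i : (i < 10)%N -> (0 < mult R (offA N) i)%N by apply: pos; left.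
have pB i : (i < 10)%N -> (0 < mult R (offB N) i)%N by apply: pos; right.
exists #|{: rows (mult R (offA N)) (mult R (offB N))}|, 10%N, (Mx R _ _); split.
  by rewrite -(ltr0n R) card_rows mulr_gt0 // sum_mult_gt0 // ?pA ?pB.
split=> //; split; first exact: Mx_pm; split; first exact: margin_Mx.
have [t0 t1] : 0 < 1 / 5 :> R /\ 1 / 5 < 1 :> R by clear; split; lra.
exact: (no_finite_cycle fA fB t0 t1 la0 la1 indep).
Qed.
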